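(* Let $\mathfrak g$ be an almost Lie algebra, and let $\mathrm{d}=D+\hat J+\hat\delta$ be the differential on $C^\bullet=\wedge^\bullet\mathfrak g^*\otimes S^\bullet\mathfrak g^*$ defined in the context. Then its cohomology is $H^0(\mathfrak g,\mathrm{d})=\mathbb{R}$ and $H^{n}(\mathfrak g,\mathrm{d})=0$ for all $n>0$.
   Context: An almost Lie algebra is an almost Lie algebroid over a point, i.e. a finite-dimensional real vector space $\mathfrak g$ with an arbitrary skew-symmetric bilinear operation $[\cdot,\cdot]\colon\wedge^2\mathfrak g\to\mathfrak g$ (no Jacobi identity is required); the anchor is zero, so its kernel is $F=\mathfrak g$. Jacobiator: $J(\phi,\psi,\chi)=[\phi,[\psi,\chi]]+[\psi,[\chi,\phi]]+[\chi,[\phi,\psi]]$, so $J\in\wedge^3\mathfrak g^*\otimes\mathfrak g$. Cochains: $C^n=\bigoplus_{p+2q=n}\wedge^p\mathfrak g^*\otimes S^q\mathfrak g^*$, a graded commutative algebra generated by $\wedge^1\mathfrak g^*=\mathfrak g^*$ in degree 1 and $S^1\mathfrak g^*=\mathfrak g^*$ in degree 2. An odd derivative is a linear map $X\colon C^\bullet\to C^{\bullet+1}$ with $X(\gamma_1\gamma_2)=X(\gamma_1)\gamma_2+(-1)^{|\gamma_1|}\gamma_1X(\gamma_2)$, where $|\gamma|$ denotes the degree; it vanishes on constants $\mathbb{R}=C^0$ and is determined by its values on $\alpha\in\wedge^1\mathfrak g^*$ and $\beta\in S^1\mathfrak g^*$. The three odd derivatives are: - $D$: $D\alpha\in\wedge^2\mathfrak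 g^*$ with $D\alpha(\psi_0,\psi_1)=-\alpha([\psi_0,\psi_1])$; $D\beta\in\mathfrak g^*\otimes S^1\mathfrak g^*$ with $\langle D\beta(\psi),v\rangle=-\langle\beta,[\psi,v]\rangle$. - $\hat\delta$: $\hat\delta(\alpha)=\alpha$ regarded as an element of $S^1\mathfrak g^*$; $\hat\delta(\beta)=0$. - $\hat J$: $\hat J(\alpha)=0$; $\hat J(\beta)=\langle\beta,J(\cdot,\cdot,\cdot)\rangle\in\wedge^3\mathfrak g^*$. The map $\mathrm{d}=D+\hat J+\hat\delta\colon C^n\to C^{n+1}$ satisfies $\mathrm{d}^2=0$, and $H^n(\mathfrak g,\mathrm{d})=\ker(\mathrm{d}|_{C^n})/\mathrm{d}(C^{n-1})$. *)

(* Defs.v *)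
From HB Require Import structures.
From mathcomp Require Import all_boot all_order all_algebra.
From mathcomp Require Import sesquilinear.
From mathcomp Require Import zify.
From mathcomp Require Import boolp functions reals.

Set Implicit Arguments.
Unset Strict Implicit.
Unset Printing Implicit Defensive.

Import Order.TTheory GRing.Theory Num.Theory.
Local Open Scope ring_scope.
Local Open Scope quotient_scope.

Section QuotientModule.
Variables (R : pzRingType) (V : lmodType R) (B : {pred V}) (B_submod : submod_closed B).

(* Dummy argument: lets the closure proof be found by unification. *)
Definition submod_pred (_ : submod_closed B) : {pred V} := B.
HB.instance Definition _ :=
  GRing.isSubmodClosed.Build R V (submod_pred B_submod) B_submod.

Definition quotmod := Quotient.quot (submod_pred B_submod).
HB.instance Definition _ := GRing.Zmodule.on quotmod.
HB.instance Definition _ : EqQuotient V (Quotient.equiv (submod_pred B_submod)) quotmod :=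
  EqQuotient.on quotmod.
HB.instance Definition _ := @isZmodQuotient.Build V (Quotient.equiv (submod_pred B_submod))
  0 -%R +%R quotmod (lock _) (@Quotient.pi_opp _ (submod_pred B_submod))
  (@Quotient.pi_add _ (submod_pred B_submod)).

Definition quot_scale (a : R) : quotmod -> quotmod := lift_op1 quotmod ( *:%R a).

Lemma pi_quot_scale a : {morph \pi_quotmod : x / a *: x >-> quot_scale a x}.
Proof.
move=> x; unlock quot_scale; apply/eqP.
rewrite -(Quotient.idealrBE (submod_pred B_submod)) -scalerBr.
rewrite rpredZ //.
by rewrite (Quotient.idealrBE (submod_pred B_submod)) reprK.
Qed.
Canonical pi_quot_scale_morph a := PiMorph1 (pi_quot_scale a).

Fact quot_scaleA a b x : quot_scale a (quot_scale b x) = quot_scale (a * b) x.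
Proof. by rewrite -[x]reprK !piE scalerA. Qed.
Fact quot_scale1 : left_id 1 quot_scale.
Proof. by move=> x; rewrite -[x]reprK !piE scale1r. Qed.
Fact quot_scaleDr : right_distributive quot_scale +%R.
Proof. by move=> a x y; rewrite -[x]reprK -[y]reprK !piE scalerDr. Qed.
Fact quot_scaleDl x : {morph quot_scale^~ x : a b / a + b}.
Proof. by move=> a b; rewrite -[x]reprK !piE scalerDl. Qed.

HB.instance Definition _ := GRing.Zmodule_isLmodule.Build R quotmod
  quot_scaleA quot_scale1 quot_scaleDr quot_scaleDl.
End QuotientModule.

Section Cohomology.
Variables (R : pzRingType) (C : nat -> lmodType R).
Variable d : forall n, {linear C n -> C n.+1}.

Definition is_cocycle n : {pred C n} := [pred c | d n c == 0].

Fact is_cocycle_submod n : submod_closed (@is_cocycle n).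
Proof.
split=> [|a x y]; rewrite !inE ?linear0 // => /eqP dx /eqP dy.
by rewrite linearP /= dx dy scaler0 addr0.
Qed.
HB.instance Definition _ n :=
  GRing.isSubmodClosed.Build R (C n) (@is_cocycle n) (is_cocycle_submod n).

Record cocycle n := Cocycle { cocycle_val :> C n; _ : cocycle_val \in @is_cocycle n }.
HB.instance Definition _ n := [isSub for @cocycle_val n].
HB.instance Definition _ n := [Choice of cocycle n by <:].
HB.instance Definition _ n := [SubChoice_isSubLmodule of cocycle n by <:].

(* C^(-1) = 0 in degree 0. *)
Definition in_image n : C n -> Prop :=
  match n with
  | 0 => fun c => c = 0
  | m.+1 => fun c => exists b : C m, c = d m b
  end.

Definition is_coboundary n : {pred cocycle n} := fun z => `[< in_image (cocycle_val z) >].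

Fact is_coboundary_submod n : submod_closed (@is_coboundary n).
Proof.
split=> [|a x y].
  by apply/asboolP; case: n => [|n] //=; exists 0; rewrite linear0.
move=> /asboolP hx /asboolP hy; apply/asboolP; case: n x y hx hy => [|n] x y /=.
  by move=> -> ->; rewrite scaler0 addr0.
by move=> [b ->] [c ->]; exists (a *: b + c); rewrite linearP.
Qed.

Definition cohomology n : lmodType R := quotmod (@is_coboundary_submod n).
End Cohomology.

Section Cochains.
Variables (R : realType) (g : vectType R).

Local Notation form := (seq g -> seq g -> R^o).
Local Notation dual := 'Hom(g, R^o).
Implicit Types (f h k : form) (u w : seq g -> R^o) (xs vs : seq g).
Implicit Types (alpha beta : dual).

(* An element of wedge^p g^* (x) S^q g^* is encoded as the multilinear form     *)
(* (x_1, .., x_p; v_1, .., v_q) |-> f [:: x_1; ..; x_p] [:: v_1; ..; v_q] that  *)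
(* is alternating in the x_i and symmetric in the v_j; an element of C^n is the *)
(* family of such forms for p + 2 q = n, extended by 0 to other lengths.        *)
Definition has_degree n f :=
  forall xs vs, (size xs + 2 * size vs)%N <> n -> f xs vs = 0.

Definition multilinear u :=
  forall xs1 xs2 (a : R) x y,
    u (xs1 ++ (a *: x + y) :: xs2) = a * u (xs1 ++ x :: xs2) + u (xs1 ++ y :: xs2).

Definition alternating u := forall xs, ~~ uniq xs -> u xs = 0.

Definition symmetric_form u := forall vs ws, perm_eq vs ws -> u vs = u ws.

Definition cochain_axiom n f :=
  [/\ has_degree n f,
      forall vs, multilinear (f^~ vs) /\ alternating (f^~ vs)
    & forall xs, multilinear (f xs) /\ symmetric_form (f xs)].

Definition is_cochain n : {pred form} := fun f => `[< cochain_axiom n f >].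

Lemma formD f h xs vs : (f + h) xs vs = f xs vs + h xs vs. Proof. by []. Qed.
Lemma formZ a f xs vs : (a *: f) xs vs = a * f xs vs. Proof. by []. Qed.

Fact is_cochain_submod n : submod_closed (is_cochain n).
Proof.
split=> [|a f h].
  by apply/asboolP; split=> // [vs|xs]; split=> // xs1 xs2 a x y;
    rewrite (_ : forall xs vs, (0 : form) xs vs = 0) // mulr0 addr0.
move=> /asboolP[fd fa fs] /asboolP[hd ha hs]; apply/asboolP; split=> [xs vs ne|vs|xs].
- by rewrite formD formZ fd // hd // mulr0 addr0.
- have [[fm fl] [hm hl]] := (fa vs, ha vs); split=> [xs1 xs2 b x y|xs xsu].
    by rewrite !(formD, formZ) fm hm !mulrDr !(mulrCA b) addrACA.
  by rewrite formD formZ fl // hl // mulr0 addr0.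
- have [[fm fl] [hm hl]] := (fs xs, hs xs); split=> [xs1 xs2 b x y|vs ws vw].
    by rewrite !(formD, formZ) fm hm !mulrDr !(mulrCA b) addrACA.
  by rewrite !(formD, formZ) (fl _ _ vw) (hl _ _ vw).
Qed.
HB.instance Definition _ n :=
  GRing.isSubmodClosed.Build R form (is_cochain n) (is_cochain_submod n).

Record cochain n := Cochain { cochain_val :> form; _ : cochain_val \in is_cochain n }.
HB.instance Definition _ n := [isSub for @cochain_val n].
HB.instance Definition _ n := [Choice of cochain n by <:].
HB.instance Definition _ n := [SubChoice_isSubLmodule of cochain n by <:].

(* The product is the graded shuffle product of forms, normalised so that       *)
(* (alpha beta)(x, y) = alpha x * beta y - alpha y * beta x on covectors. It is *)
(* computed one argument at a time, by the Leibniz rules of the contractions:   *)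
(* i_x (f h) = (i_x f) h + (-1)^p f (i_x h) for f of exterior degree p, where   *)
(* i_x f = contract x f and (-1)^p f = parity f, and                            *)
(* d_v (f h) = (d_v f) h + f (d_v h) for the symmetric arguments.               *)
Definition contract x f : form := fun xs vs => f (x :: xs) vs.
Definition parity f : form := fun xs vs => (-1) ^+ size xs * f xs vs.

Fixpoint mul_sym u w vs : R^o :=
  if vs is v :: vs' then
    mul_sym (fun ws => u (v :: ws)) w vs' + mul_sym u (fun ws => w (v :: ws)) vs'
  else u [::] * w [::].

Fixpoint mul_form f h xs : seq g -> R^o :=
  if xs is x :: xs' then
    fun vs => mul_form (contract x f) h xs' vs + mul_form (parity f) (contract x h) xs' vs
  else mul_sym (f [::]) (h [::]).

Definition partial v f : form := fun xs vs => f xs (v :: vs).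

Lemma mul_symD u1 u2 w vs :
  mul_sym (fun ws => u1 ws + u2 ws) w vs = mul_sym u1 w vs + mul_sym u2 w vs.
Proof.
elim: vs u1 u2 w => [|v vs IH] u1 u2 w /=; first by rewrite mulrDl.
by rewrite !IH addrACA.
Qed.

Lemma mul_symZ a u w vs : mul_sym (fun ws => a * u ws) w vs = a * mul_sym u w vs.
Proof.
elim: vs u w => [|v vs IH] u w /=; first by rewrite mulrA.
by rewrite !IH mulrDr.
Qed.

Lemma mul_symC u w vs : mul_sym u w vs = mul_sym w u vs.
Proof.
elim: vs u w => [|v vs IH] u w /=; first by rewrite mulrC.
by rewrite addrC; congr (_ + _).
Qed.

Lemma mul_symA u1 u2 u3 vs :
  mul_sym u1 (mul_sym u2 u3) vs = mul_sym (mul_sym u1 u2) u3 vs.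
Proof.
elim: vs u1 u2 u3 => [|v vs IH] u1 u2 u3 /=; first by rewrite mulrA.
rewrite mul_symD (mul_symC u1 (fun ws => _ + _)) mul_symD -!(mul_symC u1) !IH.
by rewrite addrA.
Qed.

Lemma contractD x f h : contract x (f + h) = contract x f + contract x h.
Proof. by []. Qed.
Lemma contractZ x a f : contract x (a *: f) = a *: contract x f.
Proof. by []. Qed.
Lemma parityD f h : parity (f + h) = parity f + parity h.
Proof. by apply/funext=> xs; apply/funext=> vs; exact: mulrDr. Qed.
Lemma parityZ a f : parity (a *: f) = a *: parity f.
Proof. by apply/funext=> xs; apply/funext=> vs; exact: mulrCA. Qed.
Lemma parityK f : parity (parity f) = f.
Proof. by apply/funext=> xs; apply/funext=> vs; exact: signrMK. Qed.
Lemma contract_parity x f : contract x (parity f) = - parity (contract x f).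
Proof.
by apply/funext=> xs; apply/funext=> vs; rewrite /contract /parity /= exprS -mulrA mulN1r.
Qed.
Lemma partial_parity v f : partial v (parity f) = parity (partial v f).
Proof. by []. Qed.

Lemma mul_formD f1 f2 h : mul_form (f1 + f2) h = mul_form f1 h + mul_form f2 h.
Proof.
apply/funext=> xs; apply/funext=> vs.
elim: xs f1 f2 h vs => [|x xs IH] f1 f2 h vs /=; first exact: mul_symD.
by rewrite contractD parityD !IH !formD /= addrACA.
Qed.

Lemma mul_formZ a f h : mul_form (a *: f) h = a *: mul_form f h.
Proof.
apply/funext=> xs; apply/funext=> vs.
elim: xs f h vs => [|x xs IH] f h vs /=; first exact: mul_symZ.
by rewrite contractZ parityZ !IH !formZ /= mulrDr.
Qed.

Lemma mul_formDr f h1 h2 : mul_form f (h1 + h2) = mul_form f h1 + mul_form f h2.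
Proof.
apply/funext=> xs; apply/funext=> vs.
elim: xs f h1 h2 vs => [|x xs IH] f h1 h2 vs /=.
  by rewrite formD /= !(mul_symC (f [::])); exact: mul_symD.
by rewrite contractD !IH !formD /= addrACA.
Qed.

Lemma mul_formZr a f h : mul_form f (a *: h) = a *: mul_form f h.
Proof.
apply/funext=> xs; apply/funext=> vs.
elim: xs f h vs => [|x xs IH] f h vs /=.
  by rewrite formZ /= !(mul_symC (f [::])); exact: mul_symZ.
by rewrite contractZ !IH !formZ /= mulrDr.
Qed.

Lemma mul_formN f h : mul_form (- f) h = - mul_form f h.
Proof. by rewrite -scaleN1r mul_formZ scaleN1r. Qed.
Lemma mul_formNr f h : mul_form f (- h) = - mul_form f h.
Proof. by rewrite -scaleN1r mul_formZr scaleN1r. Qed.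
Lemma mul0form f : mul_form 0 f = 0.
Proof. by have := mul_formZ 0 0 f; rewrite !scale0r. Qed.
Lemma mulform0 f : mul_form f 0 = 0.
Proof. by have := mul_formZr 0 f 0; rewrite !scale0r. Qed.

Lemma contract_mul x f h : contract x (mul_form f h) =
  mul_form (contract x f) h + mul_form (parity f) (contract x h).
Proof. by []. Qed.

Lemma partial_mul v f h :
  partial v (mul_form f h) = mul_form (partial v f) h + mul_form f (partial v h).
Proof.
apply/funext=> xs; apply/funext=> vs.
rewrite formD /partial; elim: xs f h vs => [|x xs IH] f h vs //=.
by rewrite !IH addrACA.
Qed.

Lemma parity_mul f h : parity (mul_form f h) = mul_form (parity f) (parity h).
Proof.
apply/funext=> xs; apply/funext=> vs.
elim: xs f h vs => [|x xs IH] f h vs /=.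
  rewrite [LHS]mul1r; congr mul_sym; apply/funext=> ws; exact/esym/mul1r.
rewrite {1}/parity /= exprS -mulrA mulrDr.
have E f' h' : (-1) ^+ size xs * mul_form f' h' xs vs =
    mul_form (parity f') (parity h') xs vs by exact: IH.
by rewrite !E !contract_parity mul_formN mul_formNr mulN1r opprD.
Qed.

Lemma mul_formA f h k : mul_form f (mul_form h k) = mul_form (mul_form f h) k.
Proof.
apply/funext=> xs; apply/funext=> vs.
elim: xs f h k vs => [|x xs IH] f h k vs /=; first exact: mul_symA.
rewrite !contract_mul mul_formD mul_formDr !formD !IH parity_mul addrA //.
Qed.

Lemma mul_formC (odd : bool) f h : parity f = (-1) ^+ odd *: f ->
  mul_form f h = mul_form (iter odd parity h) f.
Proof.
move=> fP; apply/funext=> xs; apply/funext=> vs.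
elim: xs odd f h fP vs => [|x xs IH] odd f h fP vs /=.
  rewrite mul_symC; congr (mul_sym _ _ _); apply/funext=> ws.
  by case: (odd) => //=; rewrite /parity expr0 mul1r.
have cP : parity (contract x f) = (-1) ^+ (~~ odd) *: contract x f.
  rewrite -[LHS]opprK -contract_parity fP contractZ -scaleNr.
  by congr (_ *: _); case: (odd); rewrite ?opprK.
rewrite (IH _ _ _ cP) fP mul_formZ formZ (IH _ _ _ fP).
case: (odd) => /=; last by rewrite expr0 mul1r addrC.
rewrite mulN1r contract_parity mul_formN parityK addrC //.
Qed.

Lemma mul_degree m n f h :
  has_degree m f -> has_degree n h -> has_degree (m + n) (mul_form f h).
Proof.
have symP (i j a b : nat) u w vs :
    (forall ws, (i + 2 * size ws)%N <> a -> u ws = 0) ->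
    (forall ws, (j + 2 * size ws)%N <> b -> w ws = 0) ->
    (i + j + 2 * size vs)%N <> (a + b)%N -> mul_sym u w vs = 0.
  elim: vs i j u w => [|v vs IH] i j u w uP wP ne /=.
    have [ia|/eqP ia] := eqVneq i a; last by rewrite uP ?mul0r //= muln0 addn0.
    by rewrite wP ?mulr0 //= muln0 addn0 => jb; apply: ne; rewrite /=; lia.
  rewrite /= in ne; rewrite (IH i.+2 j) ?(IH i j.+2) ?addr0 //; first last.
  - lia.
  - by move=> ws ne'; apply: uP => /=; lia.
  - lia.
  - by move=> ws ne'; apply: wP => /=; lia.
have gen (i j a b : nat) f' h' xs vs :
    (forall ys ws, (i + size ys + 2 * size ws)%N <> a -> f' ys ws = 0) ->
    (forall ys ws, (j + size ys + 2 * size ws)%N <> b -> h' ys ws = 0) ->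
    (i + j + size xs + 2 * size vs)%N <> (a + b)%N -> mul_form f' h' xs vs = 0.
  elim: xs i j f' h' vs => [|x xs IH] i j f' h' vs fP hP ne /=.
    by apply: (symP i j a b) => [ws ne'|ws ne'|]; [apply: fP|apply: hP|];
      rewrite /= in ne *; lia.
  rewrite /= in ne; rewrite (IH i.+1 j) ?(IH i j.+1) ?addr0 //; first last.
  - lia.
  - by move=> ys ws ne'; apply: fP => /=; lia.
  - lia.
  - by move=> ys ws ne'; apply: hP => /=; lia.
  - by move=> ys ws ne'; rewrite /parity fP ?mulr0.
by move=> fd hd xs vs ne; apply: (gen 0 0 m n).
Qed.

Lemma multilinear_cons x u : multilinear u -> multilinear (fun xs => u (x :: xs)).
Proof. by move=> um xs1 xs2 a y z; exact: (um (x :: xs1)). Qed.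

Lemma multilinear_parity f vs :
  multilinear (f^~ vs) -> multilinear (parity f ^~ vs).
Proof.
move=> fm xs1 xs2 a y z; have := fm xs1 xs2 a y z => /= fm'.
by rewrite /parity fm' mulrDr mulrCA !size_cat.
Qed.

Lemma mul_multilinear_ext f h : (forall vs, multilinear (f^~ vs)) ->
  (forall vs, multilinear (h^~ vs)) -> forall vs, multilinear ((mul_form f h)^~ vs).
Proof.
move=> fm hm vs xs1; elim: xs1 f h fm hm vs => [|y xs1 IH] f h fm hm vs xs2 a x z /=.
  have cE k : (forall vs, multilinear (k^~ vs)) ->
      contract (a *: x + z) k = a *: contract x k + contract z k.
    by move=> km; apply/funext=> xs; apply/funext=> ws; exact: (km ws [::]).
  rewrite !cE // mul_formD mul_formDr mul_formZ mul_formZr !(formD, formZ).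
  by rewrite mulrDr addrACA.
rewrite (IH (contract y f) h) ?(IH (parity f) (contract y h)) ?mulrDr 1?addrACA //.
- by move=> ws; apply: multilinear_parity.
- by move=> ws; apply: (@multilinear_cons y (h^~ ws)).
- by move=> ws; apply: (@multilinear_cons y (f^~ ws)).
Qed.

Lemma mul_multilinear_sym f h : (forall xs, multilinear (f xs)) ->
  (forall xs, multilinear (h xs)) -> forall xs, multilinear (mul_form f h xs).
Proof.
move=> fm hm xs vs1 vs2 a y z.
elim: xs f h fm hm => [|x xs IH] f h fm hm /=.
  move: (f [::]) (h [::]) (fm [::]) (hm [::]) => u w {fm hm}.
  elim: vs1 u w => [|v vs1 IH] u w um wm /=.
    have cE (k : seq g -> R^o) : multilinear k -> (fun ws => k (a *: y + z :: ws)) =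
        (fun ws => a * k (y :: ws) + k (z :: ws)).
      by move=> km; apply/funext=> ws; exact: (km [::]).
    rewrite !cE // mul_symD mul_symZ (mul_symC u) mul_symD mul_symZ.
    by rewrite -!(mul_symC u) mulrDr addrACA.
  rewrite (IH (fun ws => u (v :: ws))) ?(IH u) ?mulrDr 1?addrACA //;
    exact: multilinear_cons.
rewrite (IH (contract x f)) ?(IH (parity f)) ?mulrDr 1?addrACA //.
- by move=> ys ws1 ws2 b v v'; rewrite /parity fm mulrDr mulrCA.
- by move=> ys; exact: hm.
- by move=> ys; exact: fm.
Qed.

Lemma alternatingP u : multilinear u -> alternating u <->
  (forall xs1 xs2 x, u (xs1 ++ x :: x :: xs2) = 0).
Proof.
move=> um; split=> [ua xs1 xs2 x|u0 xs].
  by apply: ua; rewrite cat_uniq /= mem_head !andbF.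
have uD xs1 xs2 x y : u (xs1 ++ x + y :: xs2) = u (xs1 ++ x :: xs2) + u (xs1 ++ y :: xs2).
  by have := um xs1 xs2 1 x y; rewrite scale1r mul1r.
have uN xs1 xs2 x y : u (xs1 ++ x :: y :: xs2) = - u (xs1 ++ y :: x :: xs2).
  apply/eqP; rewrite -addr_eq0; have := u0 xs1 xs2 (x + y); rewrite uD.
  have := uD (rcons xs1 x) xs2 x y; have := uD (rcons xs1 y) xs2 x y.
  by rewrite !cat_rcons => -> ->; rewrite !u0 add0r addr0 => /eqP.
have u0' ys xs1 xs2 x : u (xs1 ++ x :: ys ++ x :: xs2) = 0.
  elim: ys xs1 => [|y ys IH] xs1 /=; first exact: u0.
  by rewrite uN -cat_rcons IH oppr0.
move=> xsN; suff [xs1 [x [ys [xs2 ->]]]] : exists xs1 x ys xs2,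
  xs = xs1 ++ x :: ys ++ x :: xs2 by exact: u0'.
elim: xs xsN => //= x xs IH; rewrite negb_and negbK => /orP[|/IH].
  by case/splitPr=> p1 p2; exists [::], x, p1, p2.
by case=> [xs1 [z [ys [xs2 ->]]]]; exists (x :: xs1), z, ys, xs2.
Qed.

Lemma mul_alternating f h :
  (forall vs, multilinear (f^~ vs) /\ alternating (f^~ vs)) ->
  (forall vs, multilinear (h^~ vs) /\ alternating (h^~ vs)) ->
  forall vs, alternating ((mul_form f h)^~ vs).
Proof.
move=> fa ha vs; apply/alternatingP.
  by apply: mul_multilinear_ext => ws; [case: (fa ws)|case: (ha ws)].
have {}fa ws xs1 xs2 x : f (xs1 ++ x :: x :: xs2) ws = 0.
  by case: (fa ws) => fm /(alternatingP fm).
have {}ha ws xs1 xs2 x : h (xs1 ++ x :: x :: xs2) ws = 0.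
  by case: (ha ws) => hm /(alternatingP hm).
move=> xs1; elim: xs1 f h vs fa ha => [|y xs1 IH] f h vs fa ha xs2 x /=.
  have c0 k : (forall ws xs1 xs2 x, k (xs1 ++ x :: x :: xs2) ws = 0) ->
      contract x (contract x k) = 0.
    by move=> ka; apply/funext=> xs; apply/funext=> ws; exact: (ka ws [::]).
  rewrite !c0 // mul0form mulform0 contract_parity mul_formN.
  have E0 ys : (0 : form) ys vs = 0 by [].
  have EN k ys : (- k : form) ys vs = - k ys vs by [].
  by rewrite !E0 EN add0r addr0 subrr.
rewrite !IH ?addr0 // => ws xs3 xs4 z; rewrite /contract -?cat_cons ?fa ?ha //.
by rewrite /parity fa mulr0.
Qed.

Lemma symmetricP u : symmetric_form u <->
  (forall vs1 vs2 x y, u (vs1 ++ x :: y :: vs2) = u (vs1 ++ y :: x :: vs2)).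
Proof.
split=> [us vs1 vs2 x y|us vs].
  by apply: us; rewrite perm_cat2l; apply/permPl; exact: (perm_catCA [:: x] [:: y]).
elim: vs u us => [|v vs IH] u us ws; first by rewrite perm_sym => /perm_nilP ->.
move=> vw; have vin : v \in ws by rewrite -(perm_mem vw) mem_head.
case/splitPr: vin vw => ws1 ws2 vw.
have {}vw : perm_eq vs (ws1 ++ ws2).
  by rewrite -(perm_cons v) (perm_trans vw) //; apply/permPl/(perm_catCA ws1 [:: v]).
rewrite (IH (fun xs => u (v :: xs)) _ _ vw) => [|vs1]; last exact: (us (v :: vs1)).
have mv xs1 : u (xs1 ++ v :: ws1 ++ ws2) = u (xs1 ++ ws1 ++ v :: ws2).
  by elim: ws1 xs1 {vw} => [|z zs IHz] xs1 //=; rewrite us -!(cat_rcons z xs1) IHz.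
exact: (mv [::]).
Qed.

Lemma mul_symmetric f h : (forall xs, symmetric_form (f xs)) ->
  (forall xs, symmetric_form (h xs)) -> forall xs, symmetric_form (mul_form f h xs).
Proof.
move=> fs hs xs; elim: xs f h fs hs => [|x xs IH] f h fs hs.
  apply/symmetricP => vs1; rewrite /=.
  move: (f [::]) (h [::]) (fs [::]) (hs [::]) => u w /symmetricP us /symmetricP ws.
  elim: vs1 u w us ws => [|v vs1 IH] u w us ws vs2 x y /=.
    have sE (k : seq g -> R^o) : (forall vs1 vs2 x y, k (vs1 ++ x :: y :: vs2) = k (vs1 ++ y :: x :: vs2)) ->
        (fun zs => k (x :: y :: zs)) = (fun zs => k (y :: x :: zs)).
      by move=> ks; apply/funext=> zs; exact: (ks [::]).
    by rewrite (sE u) // (sE w) // addrACA [X in _ + X]addrC addrACA.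
  by congr (_ + _); apply: IH => // vs3; [exact: (us (v :: vs3))|exact: (ws (v :: vs3))].
move=> vs ws vw /=; congr (_ + _); apply: IH => // ys zs1 zs2 zs; rewrite /contract ?(fs _ _ _ zs) ?(hs _ _ _ zs) //.
by rewrite /parity (fs _ _ _ zs).
Qed.

Fact mul_cochain_subproof m n (f : cochain m) (h : cochain n) :
  mul_form f h \in is_cochain (m + n).
Proof.
case: f h => f /asboolP[fd fa fs] [h /asboolP[hd ha hs]] /=; apply/asboolP; split.
- exact: mul_degree.
- move=> vs; split; last exact: mul_alternating.
  by apply: mul_multilinear_ext => ws; [case: (fa ws)|case: (ha ws)].
- move=> xs; split.
    by apply: mul_multilinear_sym => ys; [case: (fs ys)|case: (hs ys)].
  by apply: mul_symmetric => ys; [case: (fs ys)|case: (hs ys)].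
Qed.

(* Equations between products in C^(m + n) are stated on the underlying forms,  *)
(* which avoids casts between cochain n and cochain n' for provably equal n, n'. *)
Definition mul_cochain m n (f : cochain m) (h : cochain n) : cochain (m + n) :=
  Cochain (mul_cochain_subproof f h).

Definition wedge1_form alpha : form := fun xs vs =>
  match xs, vs with [:: x], [::] => alpha x | _, _ => 0 end.

Definition sym1_form beta : form := fun xs vs =>
  match xs, vs with [::], [:: v] => beta v | _, _ => 0 end.

Fact wedge1_subproof alpha : wedge1_form alpha \in is_cochain 1.
Proof.
apply/asboolP; split=> [[|x [|y xs]] [|v vs]|vs|xs] //=; split.
- by case=> [|y [|z xs1]] [|z' xs2] a x w; case: vs => [|v vs] /=;
    rewrite ?mulr0 ?addr0 // linearP.
- by case=> [|x [|y xs]] //; case: vs.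
- by case: xs => [|x [|y xs]] [|v vs1] vs2 a z w /=; rewrite mulr0 addr0.
- by case: xs => [|x [|y xs]] [|v vs] [|w ws] //= /perm_size.
Qed.

Fact sym1_subproof beta : sym1_form beta \in is_cochain 2.
Proof.
apply/asboolP; split=> [[|x xs] [|v [|w vs]]|vs|xs] //=; split.
- by case=> [|y xs1] xs2 a x w /=; rewrite mulr0 addr0.
- by case.
- by case: xs => [|x xs] [|v [|v' vs1]] [|v'' vs2] a z w /=;
    rewrite ?mulr0 ?addr0 // linearP.
- case: xs => [|x xs] [|v [|v' vs]] [|w [|w' ws]] //= vw; have:= perm_size vw => //= _.
  by have := perm_mem vw v; rewrite mem_head inE => /esym/eqP ->.
Qed.

Definition wedge1 alpha : cochain 1 := Cochain (wedge1_subproof alpha).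
Definition sym1 beta : cochain 2 := Cochain (sym1_subproof beta).

Lemma mul_wedge1 alpha beta x y :
  mul_cochain (wedge1 alpha) (wedge1 beta) [:: x; y] [::] =
  alpha x * beta y - alpha y * beta x.
Proof.
rewrite /= /contract /parity /= !expr0 expr1 !mul1r mulN1r !mulr0 !add0r addr0.
by rewrite mulNr.
Qed.

Variable br : {bilinear g -> g -> g}.

Definition jacobiator x y z := br x (br y z) + br y (br z x) + br z (br x y).

Definition D_wedge1 alpha : form := fun xs vs =>
  match xs, vs with [:: x; y], [::] => - alpha (br x y) | _, _ => 0 end.

Definition D_sym1 beta : form := fun xs vs =>
  match xs, vs with [:: x], [:: v] => - beta (br x v) | _, _ => 0 end.

Definition J_sym1 beta : form := fun xs vs =>
  match xs, vs with [:: x; y; z], [::] => beta (jacobiator x y z) | _, _ => 0 end.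

Definition odd_derivative (X : forall n, {linear cochain n -> cochain n.+1}) :=
  forall m n (f : cochain m) (h : cochain n),
    X (m + n)%N (mul_cochain f h) =
    mul_form (X m f) h + (-1) ^+ m *: mul_form f (X n h) :> form.

Definition is_D (D : forall n, {linear cochain n -> cochain n.+1}) :=
  [/\ odd_derivative D,
      forall alpha, D 1 (wedge1 alpha) = D_wedge1 alpha :> form
    & forall beta, D 2 (sym1 beta) = D_sym1 beta :> form].

Definition is_deltahat (delta : forall n, {linear cochain n -> cochain n.+1}) :=
  [/\ odd_derivative delta,
      forall alpha, delta 1 (wedge1 alpha) = sym1 alpha
    & forall beta, delta 2 (sym1 beta) = 0].

Definition is_Jhat (J : forall n, {linear cochain n -> cochain n.+1}) :=
  [/\ odd_derivative J,
      forall alpha, J 1 (wedge1 alpha) = 0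
    & forall beta, J 2 (sym1 beta) = J_sym1 beta :> form].

Definition differential (D J delta : forall n, {linear cochain n -> cochain n.+1}) n :
    {linear cochain n -> cochain n.+1} :=
  D n \+ J n \+ delta n.

Hypothesis br_skew : forall x y, br x y = - br y x.

Lemma brxx x : br x x = 0.
Proof.
have /eqP := br_skew x x; rewrite -addr_eq0 -mulr2n -scaler_nat scaler_eq0.
by rewrite pnatr_eq0 /= => /eqP.
Qed.

Lemma D_wedge1_cochain alpha : D_wedge1 alpha \in is_cochain 2.
Proof.
apply/asboolP; split=> [[|x [|y [|z xs]]] [|v vs]|vs|xs] //=; split.
- by case=> [|y [|z [|t xs1]]] [|z' [|t' xs2]] a x w; case: vs => [|v vs] /=;
    rewrite ?mulr0 ?addr0 // ?linearPl ?linearPr linearP opprD mulrN.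
- case=> [|x [|y [|z xs]]] //; case: vs => //=; rewrite inE andbT negbK => /eqP ->.
  by rewrite brxx linear0 oppr0.
- by case: xs => [|x [|y [|t xs]]] [|v vs1] vs2 a z w /=; rewrite mulr0 addr0.
- by case: xs => [|x [|y [|t xs]]] [|v vs] [|w ws] //= /perm_size.
Qed.

Lemma D_sym1_cochain beta : D_sym1 beta \in is_cochain 3.
Proof.
apply/asboolP; split=> [[|x [|y xs]] [|v [|w vs]]|vs|xs] //=; split.
- by case=> [|y [|z xs1]] [|z' xs2] a x w; case: vs => [|v [|v' vs]] /=;
    rewrite ?mulr0 ?addr0 // linearPl linearP opprD mulrN.
- by case=> [|x [|y xs]] //; case: vs.
- by case: xs => [|x [|t xs]] [|v [|v' vs1]] [|v'' vs2] a z w /=;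
    rewrite ?mulr0 ?addr0 // linearPr linearP opprD mulrN.
- case: xs => [|x [|t xs]] [|v [|v' vs]] [|w [|w' ws]] //= vw; have:= perm_size vw => //= _.
  by have := perm_mem vw v; rewrite mem_head inE => /esym/eqP ->.
Qed.

Lemma J_sym1_cochain beta : J_sym1 beta \in is_cochain 3.
Proof.
have brDr a x y z : br x (a *: y + z) = a *: br x y + br x z by rewrite linearPr.
have brDl a x y z : br (a *: y + z) x = a *: br y x + br z x by rewrite linearPl.
apply/asboolP; split=> [[|x [|y [|z [|t xs]]]] [|v vs]|vs|xs] //=; split.
- have jD a b b1 b2 c c1 c2 e e1 e2 : b = a *: b1 + b2 -> c = a *: c1 + c2 ->
     e = a *: e1 + e2 -> beta (b + c + e) = a * beta (b1 + c1 + e1) + beta (b2 + c2 + e2).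
    by move=> -> -> ->; rewrite [X in X + _]addrACA -scalerDr addrACA -scalerDr linearP.
  by case=> [|y [|z [|t [|s xs1]]]] [|z' [|t' [|s' xs2]]] a x w; case: vs => [|v vs] /=;
    rewrite ?mulr0 ?addr0 //; apply: jD; rewrite ?brDl ?brDr ?brDl ?brDr.
- case=> [|x [|y [|z [|t xs]]]] //; case: vs => //=.
  have j0 a b : jacobiator a a b = 0.
    by rewrite /jacobiator brxx [br b a]br_skew linearNr linear0r addr0 subrr.
  rewrite !inE negb_and negbK andbT negbK => /orP[/orP[]|] /eqP ->.
  + by rewrite j0 linear0.
  + by rewrite /jacobiator addrC addrA [X in beta X]j0 linear0.
  + by rewrite /jacobiator -addrA addrC [X in beta X]j0 linear0.
- by case: xs => [|x [|y [|t [|s xs]]]] [|v vs1] vs2 a z w /=; rewrite mulr0 addr0.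
- by case: xs => [|x [|y [|t [|s xs]]]] [|v vs] [|w ws] //= /perm_size.
Qed.

Lemma parity_cochain n f : f \in is_cochain n -> parity f = (-1) ^+ n *: f.
Proof.
move=> /asboolP[fd _ _]; apply/funext=> xs; apply/funext=> vs; rewrite formZ /parity.
have [<-|/eqP ne] := eqVneq (size xs + 2 * size vs)%N n; last by rewrite fd ?mulr0.
by rewrite exprD exprM sqrrN !expr1n mulr1.
Qed.

Lemma contract0 x f : f \in is_cochain 0 -> contract x f = 0.
Proof.
by move=> /asboolP[fd _ _]; apply/funext=> xs; apply/funext=> vs; rewrite [LHS]fd.
Qed.

Lemma contract_cochain n x f : f \in is_cochain n.+1 -> contract x f \in is_cochain n.
Proof.
move=> /asboolP[fd fa fs]; apply/asboolP; split=> [xs vs ne|vs|xs].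
- by apply: fd => /=; lia.
- have [fm fl] := fa vs; split; first exact: (multilinear_cons x fm).
  by move=> xs xsu; apply: fl; rewrite /= negb_and xsu orbT.
- exact: (fs (x :: xs)).
Qed.

Lemma partial0 n v f : (n < 2)%N -> f \in is_cochain n -> partial v f = 0.
Proof.
move=> n2 /asboolP[fd _ _]; apply/funext=> xs; apply/funext=> vs; apply: fd => /=; lia.
Qed.

Lemma partial_cochain n v f : f \in is_cochain n.+2 -> partial v f \in is_cochain n.
Proof.
move=> /asboolP[fd fa fs]; apply/asboolP; split=> [xs vs ne|vs|xs].
- by apply: fd => /=; lia.
- exact: (fa (v :: vs)).
- have [fm fl] := fs xs; split; first exact: (multilinear_cons v fm).
  by move=> ws zs wz; apply: fl; rewrite perm_cons.
Qed.

Definition const_form (c : R) : form := fun xs vs =>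
  match xs, vs with [::], [::] => c | _, _ => 0 end.

Lemma mul_form1 f : mul_form f (const_form 1) = f.
Proof.
apply/funext=> xs; apply/funext=> vs; elim: xs f vs => [|x xs IH] f vs /=.
  elim: vs (f [::]) => [|v vs IH] u /=; first exact: mulr1.
  rewrite IH (_ : (fun ws => _) = (fun ws => 0 * u ws)); last by apply/funext=> ws; rewrite mul0r.
  by rewrite mul_symC mul_symZ mul0r addr0.
by rewrite IH (_ : contract x (const_form 1) = 0) // mulform0 addr0.
Qed.

(* The odd derivative with prescribed values A, B on wedge1 and sym1, written   *)
(* in a basis e_i of g with dual basis e^i as                                   *)
(* sum_i A(e^i) contract e_i + sum_i B(e^i) partial e_i.                        *)
Section Extension.
Variables (A B : {linear dual -> form}).
Hypothesis A_cochain : forall alpha, A alpha \in is_cochain 2.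
Hypothesis B_cochain : forall beta, B beta \in is_cochain 3.

Let e := vbasis {:g}.
Let dual_basis i : dual := linfun (coord e i : g -> R^o).

Definition ext_form f : form :=
  \sum_i mul_form (A (dual_basis i)) (contract e`_i f) +
  \sum_i mul_form (B (dual_basis i)) (partial e`_i f).

Lemma mul_is_cochain m n f h : f \in is_cochain m -> h \in is_cochain n ->
  mul_form f h \in is_cochain (m + n).
Proof. by move=> fm hn; exact: (mul_cochain_subproof (Cochain fm) (Cochain hn)). Qed.

Lemma ext_form_cochain n f : f \in is_cochain n -> ext_form f \in is_cochain n.+1.
Proof.
move=> fn; rewrite rpredD //; apply: rpred_sum => i _.
  case: n fn => [|n] fn; first by rewrite contract0 // mulform0 rpred0.
  exact: (mul_is_cochain (A_cochain _) (contract_cochain _ fn)).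
case: n fn => [|[|n]] fn; try by rewrite (partial0 _ _ fn) // mulform0 rpred0.
exact: (mul_is_cochain (B_cochain _) (partial_cochain _ fn)).
Qed.

Definition ext_fun n (f : cochain n) : cochain n.+1 :=
  Cochain (ext_form_cochain (valP f)).

Lemma ext_form_linear : linear ext_form.
Proof.
move=> a f h; rewrite /ext_form scalerDr addrACA !scaler_sumr.
congr (_ + _); rewrite -big_split; apply: eq_bigr => i _ /=.
  by rewrite contractD contractZ mul_formDr mul_formZr.
by rewrite -mul_formZr -mul_formDr.
Qed.

Fact ext_fun_linear n : linear (@ext_fun n).
Proof.
move=> a f h; apply: val_inj; rewrite [RHS](linearP \val).
rewrite -ext_form_linear [LHS]/=; congr ext_form; exact: (linearP \val).
Qed.
HB.instance Definition _ n := GRing.isLinear.Build R (cochain n) (cochain n.+1) _ _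
  (@ext_fun_linear n).

Lemma ext_form_mul m n f h : f \in is_cochain m -> h \in is_cochain n ->
  ext_form (mul_form f h) =
  mul_form (ext_form f) h + (-1) ^+ m *: mul_form f (ext_form h).
Proof.
move=> fm hn.
have suml I (r : seq I) (F : I -> form) k :
    mul_form (\sum_(i <- r) F i) k = \sum_(i <- r) mul_form (F i) k.
  by elim/big_rec2: _ => [|i x y _ <-]; rewrite ?mul0form ?mul_formD.
have sumr I (r : seq I) (F : I -> form) k :
    mul_form k (\sum_(i <- r) F i) = \sum_(i <- r) mul_form k (F i).
  by elim/big_rec2: _ => [|i x y _ <-]; rewrite ?mulform0 ?mul_formDr.
rewrite /ext_form mul_formD mul_formDr scalerDr addrACA !suml !sumr !scaler_sumr.
congr (_ + _); rewrite -big_split; apply: eq_bigr => i _ /=.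
  rewrite contract_mul mul_formDr !mul_formA; congr (_ + _).
  rewrite (@mul_formC false (A _)) /=; last first.
    by rewrite (parity_cochain (A_cochain _)) sqrrN expr1n expr0.
  by rewrite (parity_cochain fm) !mul_formZ.
rewrite partial_mul mul_formDr !mul_formA; congr (_ + _).
rewrite (@mul_formC true (B _)) /=; last first.
  by rewrite (parity_cochain (B_cochain _)) exprS sqrrN expr1n mulr1 expr1.
by rewrite (parity_cochain fm) !mul_formZ.
Qed.

Lemma dual_expand alpha : alpha = \sum_(i < \dim {:g}) alpha e`_i *: dual_basis i.
Proof.
apply/lfunP=> x; rewrite sum_lfunE {1}(coord_vbasis (memvf x)) linear_sum.
by apply: eq_bigr => i _; rewrite linearZ scale_lfunE lfunE; exact: mulrC.
Qed.

Lemma ext_wedge1 alpha : ext_form (wedge1_form alpha) = A alpha.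
Proof.
rewrite /ext_form [X in _ + X]big1 ?addr0 => [|i _]; last first.
  rewrite (_ : partial _ _ = 0) ?mulform0 //.
  by apply/funext=> [[|x [|y xs]]]; apply/funext.
have E i : mul_form (A (dual_basis i)) (contract e`_i (wedge1_form alpha)) =
    alpha e`_i *: A (dual_basis i).
  rewrite -[in RHS](mul_form1 (A _)) -mul_formZr; congr mul_form.
  by apply/funext=> [[|x xs]]; apply/funext=> [[|v vs]]; rewrite formZ /= ?mulr1 ?mulr0.
rewrite (eq_bigr _ (fun i _ => E i)) [in RHS](dual_expand alpha) linear_sum.
by apply: eq_bigr => i _; rewrite linearZ.
Qed.

Lemma ext_sym1 beta : ext_form (sym1_form beta) = B beta.
Proof.
rewrite /ext_form big1 ?add0r => [|i _]; last first.
  by rewrite (_ : contract _ _ = 0) ?mulform0.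
have E i : mul_form (B (dual_basis i)) (partial e`_i (sym1_form beta)) =
    beta e`_i *: B (dual_basis i).
  rewrite -[in RHS](mul_form1 (B _)) -mul_formZr; congr mul_form.
  by apply/funext=> [[|x xs]]; apply/funext=> [[|v vs]]; rewrite formZ /= ?mulr1 ?mulr0.
rewrite (eq_bigr _ (fun i _ => E i)) [in RHS](dual_expand beta) linear_sum.
by apply: eq_bigr => i _; rewrite linearZ.
Qed.

Lemma odd_derivative_ext : exists X : forall n, {linear cochain n -> cochain n.+1},
  [/\ odd_derivative X, forall alpha, X 1 (wedge1 alpha) = A alpha :> form
    & forall beta, X 2 (sym1 beta) = B beta :> form].
Proof.
exists (fun n => @ext_fun n); split=> [m n [f fm] [h hn]|alpha|beta].
- exact: ext_form_mul fm hn.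
- exact: ext_wedge1.
- exact: ext_sym1.
Qed.

End Extension.

Fact D_wedge1_linear : linear D_wedge1.
Proof.
move=> a f h; apply/funext=> xs; apply/funext=> vs; rewrite formD formZ.
by case: xs vs => [|x [|y [|z xs]]] [|v vs] /=;
  rewrite ?mulr0 ?addr0 // add_lfunE scale_lfunE opprD mulrN.
Qed.
HB.instance Definition _ := GRing.isLinear.Build R dual form _ _ D_wedge1_linear.

Fact D_sym1_linear : linear D_sym1.
Proof.
move=> a f h; apply/funext=> xs; apply/funext=> vs; rewrite formD formZ.
by case: xs vs => [|x [|y xs]] [|v [|w vs]] /=;
  rewrite ?mulr0 ?addr0 // add_lfunE scale_lfunE opprD mulrN.
Qed.
HB.instance Definition _ := GRing.isLinear.Build R dual form _ _ D_sym1_linear.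

Fact J_sym1_linear : linear J_sym1.
Proof.
move=> a f h; apply/funext=> xs; apply/funext=> vs; rewrite formD formZ.
by case: xs vs => [|x [|y [|z [|t xs]]]] [|v vs] /=;
  rewrite ?mulr0 ?addr0 // add_lfunE scale_lfunE.
Qed.
HB.instance Definition _ := GRing.isLinear.Build R dual form _ _ J_sym1_linear.

Fact sym1_form_linear : linear sym1_form.
Proof.
move=> a f h; apply/funext=> xs; apply/funext=> vs; rewrite formD formZ.
by case: xs vs => [|x xs] [|v [|w vs]] /=;
  rewrite ?mulr0 ?addr0 // add_lfunE scale_lfunE.
Qed.
HB.instance Definition _ := GRing.isLinear.Build R dual form _ _ sym1_form_linear.

(* The derivatives specified by is_D, is_Jhat and is_deltahat do exist. *)
Lemma odd_derivatives_exist :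
  exists D J delta, [/\ is_D D, is_Jhat J & is_deltahat delta].
Proof.
have [D HD] := odd_derivative_ext D_wedge1_cochain D_sym1_cochain.
have [J [HJ J0 J1]] := @odd_derivative_ext \0%R J_sym1 (fun=> rpred0 _) J_sym1_cochain.
have [d [Hd d0 d1]] := @odd_derivative_ext sym1_form \0%R sym1_subproof (fun=> rpred0 _).
exists D, J, d; split=> //; split=> // alpha; apply: val_inj.
- by rewrite [LHS]J0 [RHS]raddf0.
- exact: d0.
- by rewrite [LHS]d1 [RHS]raddf0.
Qed.

End Cochains.

(* Main.v *)
Require Import Defs.
From HB Require Import structures.
From mathcomp Require Import all_boot all_order all_algebra.
From mathcomp Require Import sesquilinear.
From mathcomp Require Import boolp functions reals.
From mathcomp Require Import zify ring.

Set Implicit Arguments.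
Unset Strict Implicit.
Unset Printing Implicit Defensive.

Import Order.TTheory GRing.Theory Num.Theory.
Local Open Scope ring_scope.

(* The odd derivative d is the differential of a Weil algebra. The number p + q of factors is   *)
(* sum_i e^i i_{e_i} + sum_i f^i d_{e_i}, with f^i the copy of e^i in S^1, hence cochains are   *)
(* generated by wedge^1 and S^1. On S^1 one has beta = d alpha - D alpha, where alpha is beta   *)
(* seen in wedge^1 and D alpha is a sum of products of elements of wedge^1, so that d^2 = 0     *)
(* follows from d^2 = 0 on wedge^1. Let s be the derivation of degree -1 that kills wedge^1 and *)
(* sends beta to alpha. Then d s + s d = (p + q) - K, where K is the derivation that kills      *)
(* wedge^1 and sends beta to D alpha; it lowers q. If c is a cocycle of degree n > 0 with       *)
(* q <= Q, then c - (n - Q)^-1 d s c is a cocycle with q < Q, and c is exact by induction on Q. *)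

(** With [delta] alone, cochains form the Koszul complex of g^*. It is contracted by the derivation
    s ([koszul_fun]) that turns symmetric generators back into exterior ones: the anticommutator of
    [delta] and s is p + q, which is invertible in positive degree. Adding [D] contributes only -K,
    and [J] contributes nothing, so [koszul_homotopy] gives d s + s d = (p + q) - K. As K lowers q
    it is nilpotent, and (p + q) - K is still invertible for n > 0. [cocycle_exact] carries out this
    inversion by descent on q; it uses d^2 = 0 ([d_square0]) so that a corrected cocycle is again a
    cocycle.

    Identities of this kind are checked on generators through [cochain_ind], which rests on the
    expansion of p + q in [euler_expand]. In degree 0 all cochains are constants, all constants are
    cocycles, and only 0 is a coboundary ([const_class_bij]). *)

Section Generators.
Variables (R : realType) (g : vectType R).
Local Notation form := (seq g -> seq g -> R^o).
Local Notation dual := 'Hom(g, R^o).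
Local Notation cochain := (cochain g).
Implicit Types (f h k : form) (alpha beta : dual) (xs vs : seq g).

Local Notation e := (vbasis {:g}).
Definition dual_vbasis (i : 'I_(\dim {:g})) : dual := linfun (coord e i : g -> R^o).

Lemma sum_dual_vbasis (V : lmodType R) (u : g -> V) (x : g) : linear u ->
  \sum_i dual_vbasis i x *: u e`_i = u x.
Proof.
move=> ul; pose u' : {linear g -> V} :=
  HB.pack u (GRing.isLinear.Build R g V _ u ul).
rewrite -[RHS]/(u' x) {2}(coord_vbasis (memvf x)) linear_sum.
by apply: eq_bigr => i _; rewrite linearZ lfunE.
Qed.

Lemma form_sumE (I : Type) (r : seq I) (P : pred I) (F : I -> form) xs vs :
  (\sum_(i <- r | P i) F i) xs vs = \sum_(i <- r | P i) F i xs vs.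
Proof. by elim/big_rec2: _ => // i y1 y2 _ <-. Qed.

Lemma mul_form_suml (I : Type) (r : seq I) (P : pred I) (F : I -> form) k :
  mul_form (\sum_(i <- r | P i) F i) k = \sum_(i <- r | P i) mul_form (F i) k.
Proof. by elim/big_rec2: _ => [|i x y _ <-]; rewrite ?mul0form ?mul_formD. Qed.

Lemma mul_form_sumr (I : Type) (r : seq I) (P : pred I) (F : I -> form) k :
  mul_form k (\sum_(i <- r | P i) F i) = \sum_(i <- r | P i) mul_form k (F i).
Proof. by elim/big_rec2: _ => [|i x y _ <-]; rewrite ?mulform0 ?mul_formDr. Qed.

Lemma parity_wedge1 alpha : parity (wedge1_form alpha) = - wedge1_form alpha.
Proof. by rewrite (parity_cochain (wedge1_subproof alpha)) scaleN1r. Qed.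

Lemma parity_sym1 beta : parity (sym1_form beta) = sym1_form beta.
Proof. by rewrite (parity_cochain (sym1_subproof beta)) sqrrN expr1n scale1r. Qed.

Lemma mul_1form h : mul_form (const_form 1) h = h.
Proof.
rewrite (@mul_formC _ _ false) ?mul_form1 // expr0 scale1r.
by apply/funext=> [[|x xs]]; apply/funext=> vs; rewrite /parity /= ?mul1r ?mulr0.
Qed.

Lemma const_formE (a : R) : const_form a = a *: const_form 1 :> form.
Proof.
by apply/funext=> [[|x xs]]; apply/funext=> [[|v vs]]; rewrite Defs.formZ /= ?mulr1 ?mulr0.
Qed.

Lemma contract_wedge1 x alpha : contract x (wedge1_form alpha) = alpha x *: const_form 1.
Proof.
by rewrite -const_formE; apply/funext=> [[|y xs]]; apply/funext=> [[|v vs]].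
Qed.

Lemma contract_sym1 x beta : contract x (sym1_form beta) = 0.
Proof. by []. Qed.

Lemma partial_wedge1 v alpha : partial v (wedge1_form alpha) = 0.
Proof. by apply/funext=> [[|x [|y xs]]]; apply/funext. Qed.

Lemma partial_sym1 v beta : partial v (sym1_form beta) = beta v *: const_form 1.
Proof.
by rewrite -const_formE; apply/funext=> [[|y xs]]; apply/funext=> [[|w vs]].
Qed.

Lemma contract_mul_wedge1 x alpha f :
  contract x (mul_form (wedge1_form alpha) f) =
  alpha x *: f - mul_form (wedge1_form alpha) (contract x f).
Proof.
by rewrite contract_mul contract_wedge1 mul_formZ mul_1form parity_wedge1 mul_formN.
Qed.

Lemma partial_mul_wedge1 v alpha f :
  partial v (mul_form (wedge1_form alpha) f) = mul_form (wedge1_form alpha) (partial v f).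
Proof. by rewrite partial_mul partial_wedge1 mul0form add0r. Qed.

Lemma contract_mul_sym1 x beta f :
  contract x (mul_form (sym1_form beta) f) = mul_form (sym1_form beta) (contract x f).
Proof. by rewrite contract_mul contract_sym1 mul0form add0r parity_sym1. Qed.

Lemma partial_mul_sym1 v beta f :
  partial v (mul_form (sym1_form beta) f) =
  beta v *: f + mul_form (sym1_form beta) (partial v f).
Proof. by rewrite partial_mul partial_sym1 mul_formZ mul_1form. Qed.

Lemma mul_form_nil f h : mul_form f h [::] [::] = f [::] [::] * h [::] [::].
Proof. by []. Qed.

Lemma mul_form_consl f h x xs vs : mul_form f h (x :: xs) vs = contract x (mul_form f h) xs vs.
Proof. by []. Qed.

Lemma mul_form_consr f h v xs vs : mul_form f h xs (v :: vs) = partial v (mul_form f h) xs vs.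
Proof. by []. Qed.

Lemma formNE f xs vs : (- f) xs vs = - f xs vs. Proof. by []. Qed.

(** Every shuffle must feed one exterior argument to alpha, and there is none. *)
Lemma wedge1_mul_nil alpha f vs : mul_form (wedge1_form alpha) f [::] vs = 0.
Proof.
elim: vs f => [|v vs IH] f; first by rewrite mul_form_nil mul0r.
by rewrite mul_form_consr partial_mul_wedge1 IH.
Qed.

Lemma sym1_mul_nil beta f xs : mul_form (sym1_form beta) f xs [::] = 0.
Proof.
elim: xs f => [|x xs IH] f; first by rewrite mul_form_nil mul0r.
by rewrite mul_form_consl contract_mul_sym1 IH.
Qed.

(** The operator p + q, counting the generators in a monomial. *)
Definition euler f : form := fun xs vs => (size xs + size vs)%:R * f xs vs.

Section CochainAxioms.
Variables (n : nat) (f : form).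
Hypothesis fn : f \in is_cochain n.

Lemma contract_linear : linear (fun x => contract x f).
Proof.
move: fn => /asboolP[_ fa _] a x y; apply/funext=> xs; apply/funext=> vs.
by case: (fa vs) => fm _; exact: (fm [::]).
Qed.

Lemma partial_linear : linear (fun v => partial v f).
Proof.
move: fn => /asboolP[_ _ fs] a x y; apply/funext=> xs; apply/funext=> vs.
by case: (fs xs) => fm _; exact: (fm [::]).
Qed.

(** Polarisation of i_z i_z = 0 at z = x + y. *)
Lemma contractC x y : contract x (contract y f) = - contract y (contract x f).
Proof.
have cc z : contract z (contract z f) = 0.
  move: fn => /asboolP[_ fa _]; apply/funext=> xs; apply/funext=> vs.
  by case: (fa vs) => _ fl; apply: (fl (z :: z :: xs)); rewrite /= mem_head.
have cD a b : contract (a + b) f = contract a f + contract b f.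
  by have := contract_linear 1 a b; rewrite !scale1r.
have := cc (x + y); rewrite cD !contractD.
have cD' a b z :
    contract (a + b) (contract z f) = contract a (contract z f) + contract b (contract z f).
  move: fn => /asboolP[_ fa _]; apply/funext=> xs; apply/funext=> vs.
  by case: (fa vs) => /(_ [:: z] xs 1 a b) + _; rewrite scale1r mul1r.
by rewrite !cD' !cc add0r addr0 => /eqP; rewrite addrC addr_eq0 => /eqP.
Qed.

Lemma partialC x y : partial x (partial y f) = partial y (partial x f).
Proof.
move: fn => /asboolP[_ _ fs]; apply/funext=> xs; apply/funext=> vs.
case: (fs xs) => _; apply.
by apply/permPl; exact: (perm_catCA [:: y] [:: x]).
Qed.
End CochainAxioms.

(** By the dual basis expansion, i_x P = P i_x + i_x for P the sum of the e^i i_{e_i}, so each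
    exterior argument that is peeled off contributes 1. *)
Lemma sum_wedge1_contract n f xs vs : f \in is_cochain n ->
  \sum_i mul_form (wedge1_form (dual_vbasis i)) (contract e`_i f) xs vs =
  (size xs)%:R * f xs vs.
Proof.
elim: xs n f => [|x xs IH] n f fn.
  by rewrite mul0r big1 // => i _; rewrite wedge1_mul_nil.
under eq_bigr => i _.
  rewrite mul_form_consl contract_mul_wedge1 Defs.formD Defs.formZ formNE (contractC fn).
  rewrite mul_formNr formNE opprK.
  over.
rewrite big_split /=.
have := congr1 (fun f : form => f xs vs) (sum_dual_vbasis x (contract_linear fn)).
rewrite form_sumE => ->.
(* A form of degree 0 has zero contractions, so the induction hypothesis is needed only in positive
   degree. *)
case: n fn => [|n] fn.
  rewrite big1 => [|i _]; last by rewrite (contract0 _ fn) mulform0.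
  move: fn => /asboolP[fd _ _].
  by rewrite /contract fd // mulr0 addr0.
by rewrite (IH _ _ (contract_cochain x fn)) -[in RHS]nat1r mulrDl mul1r.
Qed.

Lemma sum_sym1_partial n f xs vs : f \in is_cochain n ->
  \sum_i mul_form (sym1_form (dual_vbasis i)) (partial e`_i f) xs vs =
  (size vs)%:R * f xs vs.
Proof.
elim: vs n f => [|v vs IH] n f fn.
  by rewrite mul0r big1 // => i _; rewrite sym1_mul_nil.
under eq_bigr => i _.
  rewrite mul_form_consr partial_mul_sym1 Defs.formD Defs.formZ (partialC fn).
  over.
rewrite big_split /=.
have := congr1 (fun f : form => f xs vs) (sum_dual_vbasis v (partial_linear fn)).
rewrite form_sumE => ->.
case: n fn => [|[|n]] fn; last first.
- by rewrite (IH _ _ (partial_cochain v fn)) -[in RHS]nat1r mulrDl mul1r.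
all: rewrite big1 => [|i _]; last by rewrite (partial0 v _ fn) // mulform0.
all: move: fn => /asboolP[fd _ _].
all: by rewrite /partial fd ?mulr0 ?addr0 //=; lia.
Qed.

Lemma euler_expand n f : f \in is_cochain n ->
  euler f = \sum_i mul_form (wedge1_form (dual_vbasis i)) (contract e`_i f) +
            \sum_i mul_form (sym1_form (dual_vbasis i)) (partial e`_i f).
Proof.
move=> fn; apply/funext=> xs; apply/funext=> vs.
rewrite Defs.formD !form_sumE (sum_wedge1_contract _ _ fn) (sum_sym1_partial _ _ fn).
by rewrite /euler natrD mulrDl.
Qed.

Lemma contract_euler x f : contract x (euler f) = euler (contract x f) + contract x f.
Proof.
apply/funext=> xs; apply/funext=> vs; rewrite Defs.formD /contract /euler /=.
by rewrite addSn -nat1r mulrDl mul1r addrC.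
Qed.

Lemma partial_euler v f : partial v (euler f) = euler (partial v f) + partial v f.
Proof.
apply/funext=> xs; apply/funext=> vs; rewrite Defs.formD /partial /euler /=.
by rewrite addnS -nat1r mulrDl mul1r addrC.
Qed.

(** A shuffle distributes the arguments between the factors, so their number is additive. Arguments
    are peeled off one by one, each shifting [euler] by 1. *)
Lemma euler_mul f h : euler (mul_form f h) = mul_form (euler f) h + mul_form f (euler h).
Proof.
have parity_euler k : parity (euler k) = euler (parity k).
  by apply/funext=> xs; apply/funext=> vs; exact: mulrCA.
apply/funext=> xs; apply/funext=> vs; elim: xs f h vs => [|x xs IH] f h vs; last first.
  rewrite -[LHS]/(contract x (euler (mul_form f h)) xs vs).
  rewrite -[RHS]/(contract x (mul_form (euler f) h + mul_form f (euler h)) xs vs).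
  have E : euler (contract x (mul_form f h)) xs vs = euler (mul_form (contract x f) h) xs vs
    + euler (mul_form (parity f) (contract x h)) xs vs by exact: mulrDr.
  rewrite contract_euler [in LHS]Defs.formD E !IH !contractD !contract_mul parity_euler.
  rewrite !contract_euler !mul_formD !mul_formDr !Defs.formD [LHS]/=; ring.
elim: vs f h => [|v vs IH] f h.
  by rewrite Defs.formD /= /euler mul_form_nil !mul0r mulr0 addr0.
rewrite -[LHS]/(partial v (euler (mul_form f h)) [::] vs).
rewrite -[RHS]/(partial v (mul_form (euler f) h + mul_form f (euler h)) [::] vs).
have E : euler (partial v (mul_form f h)) [::] vs = euler (mul_form (partial v f) h) [::] vs
  + euler (mul_form f (partial v h)) [::] vs by rewrite partial_mul; exact: mulrDr.
have PD f1 f2 : partial v (f1 + f2) = partial v f1 + partial v f2 by [].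
rewrite partial_euler [in LHS]Defs.formD E !IH PD !partial_mul.
rewrite !partial_euler !mul_formD !mul_formDr !Defs.formD ; ring.
Qed.

(** * Components with a fixed number of symmetric arguments, and induction on generators *)

Definition sym_part (q : nat) f : form :=
  fun xs vs => if size vs == q then f xs vs else 0.

Lemma sym_part_cochain n q f : f \in is_cochain n -> sym_part q f \in is_cochain n.
Proof.
move=> /asboolP[fd fa fs]; apply/asboolP; rewrite /sym_part; split=> [xs vs ne|vs|xs].
- by rewrite fd // if_same.
- have [fm fl] := fa vs; split=> [xs1 xs2 a x y|xs xsu].
    by case: ifP => _; [exact: fm|rewrite mulr0 addr0].
  by rewrite fl // if_same.
- have [fm fl] := fs xs; split=> [vs1 vs2 a x y|vs ws vw].
    by rewrite !size_cat /=; case: ifP => _; [exact: fm|rewrite mulr0 addr0].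
  by rewrite (perm_size vw) (fl _ _ vw).
Qed.

Lemma sum_sym_part n f : f \in is_cochain n -> f = \sum_(q < n.+1) sym_part q f.
Proof.
move=> /asboolP[fd _ _]; apply/funext=> xs; apply/funext=> vs; rewrite form_sumE.
have [vn|nv] := ltnP (size vs) n.+1.
  rewrite (bigD1 (Ordinal vn)) //= /sym_part eqxx big1 ?addr0 // => i.
  by rewrite eq_sym -val_eqE /= => /negPf ->.
by rewrite fd ?big1 // => [i _|]; rewrite /sym_part ?fd ?if_same //; lia.
Qed.

(** From p + 2q = n follows p + q = n - q; the bound on q keeps the truncated subtraction honest. *)
Lemma euler_sym_part n q f : f \in is_cochain n -> (2 * q <= n)%N ->
  euler (sym_part q f) = (n - q)%:R *: sym_part q f.
Proof.
move=> /asboolP[fd _ _] qn; apply/funext=> xs; apply/funext=> vs.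
rewrite Defs.formZ /euler /sym_part; case: eqP => [vq|]; last by rewrite !mulr0.
have [E|/eqP ne] := eqVneq (size xs + 2 * size vs)%N n; last by rewrite fd ?mulr0.
by congr (_%:R * _); lia.
Qed.

Lemma cochain0E f : f \in is_cochain 0 -> f = f [::] [::] *: const_form 1.
Proof.
move=> /asboolP[fd _ _]; rewrite -const_formE.
by apply/funext=> [[|x xs]]; apply/funext=> [[|v vs]] //; rewrite fd.
Qed.

Fact const_form_subproof a : (const_form a : form) \in is_cochain 0.
Proof.
apply/asboolP; split=> [[|x xs] [|v vs]|vs|xs] //; split.
- by case=> [|z xs1] xs2 b x y; rewrite /= mulr0 addr0.
- by case.
- by case: xs => [|z xs] [|v vs1] vs2 b x y; rewrite /= mulr0 addr0.
- by case: xs => [|z xs] [|v vs] [|w ws] // /perm_size.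
Qed.

Definition const_cochain a : cochain 0 := Cochain (const_form_subproof a).

Lemma cochain_val_linear n a (b c : cochain n) : a *: b + c = a *: (b : form) + c :> form.
Proof. by rewrite [LHS](linearP \val). Qed.

Lemma cochain_valD n (b c : cochain n) : b + c = (b : form) + c :> form.
Proof. by rewrite -[b]scale1r cochain_val_linear !scale1r. Qed.

Lemma cochain_val0 n : (0 : cochain n) = 0 :> form.
Proof. by apply: (@addIr form (0 : cochain n)); rewrite -cochain_valD !add0r. Qed.

Lemma cochain_valZ n a (c : cochain n) : a *: c = a *: (c : form) :> form.
Proof. by rewrite -[a *: c]addr0 cochain_val_linear cochain_val0 addr0. Qed.

Lemma cochain_valN n (c : cochain n) : - c = - (c : form) :> form.
Proof. by rewrite -scaleN1r cochain_valZ scaleN1r. Qed.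

Lemma cochain_val_sum n I (r : seq I) (P : pred I) (F : I -> cochain n) :
  \sum_(i <- r | P i) F i = \sum_(i <- r | P i) (F i : form) :> form.
Proof.
by elim/big_rec2: _ => [|i f b _ <-]; rewrite ?cochain_val0 ?cochain_valD.
Qed.

(** This is how linear identities get reduced to generators. By strong induction on the degree,
    split a form by its number q of symmetric arguments; each component is a nonzero multiple of its
    image under [euler], which [euler_expand] writes as a sum of generators times forms of lower
    degree. *)
Lemma cochain_ind (P : forall n, cochain n -> Prop) :
  (forall n, P n 0) ->
  (forall n (a : R) (f h : cochain n), P n f -> P n h -> P n (a *: f + h)) ->
  P 0%N (const_cochain 1) ->
  (forall n alpha (f : cochain n), P n f -> P n.+1 (mul_cochain (wedge1 alpha) f)) ->
  (forall n beta (f : cochain n), P n f -> P n.+2 (mul_cochain (sym1 beta) f)) ->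
  forall n (f : cochain n), P n f.
Proof.
move=> P0 PL P1 Pw Ps; elim/ltn_ind=> n IH f.
have PZ m a (h : cochain m) : P m h -> P m (a *: h).
  by move=> Ph; rewrite -[_ *: _]addr0; exact: PL.
have Psum m (I : Type) (r : seq I) (F : I -> cochain m) :
    (forall i, P m (F i)) -> P m (\sum_(i <- r) F i).
  by move=> PF; elim/big_rec: _ => // i y _ Py; rewrite -[F i]scale1r; exact: PL.
case: n IH f => [|n] IH f.
  rewrite (_ : f = val f [::] [::] *: const_cochain 1); first exact: PZ.
  by apply: val_inj; rewrite [LHS](cochain0E (valP f)) [RHS]cochain_valZ.
have -> : f = \sum_(q < n.+2) Cochain (sym_part_cochain q (valP f)).
  by apply: val_inj; rewrite [RHS]cochain_val_sum -sum_sym_part //; exact: valP.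
apply: (Psum) => q; set fq := Cochain _.
have [qn|nq] := leqP (2 * q) n.+1; last first.
  rewrite (_ : fq = 0) //.
  apply: val_inj; apply/funext=> xs; apply/funext=> vs /=; rewrite /sym_part.
  case: eqP => // vq; have /asboolP[fd _ _] := valP f; apply: fd; lia.
(* The eigenvalue is nonzero: 2q <= n + 1 forces q < n + 1. *)
have -> : fq = (n.+1 - q)%:R^-1 *: ((n.+1 - q)%:R *: fq).
  by rewrite scalerA mulVf ?scale1r // pnatr_eq0; lia.
apply: PZ; have fqn := valP fq.
have euler_fq : (n.+1 - q)%:R *: val fq = euler (val fq).
  by rewrite (euler_sym_part (valP f)).
(* From here on it only matters that a multiple of the form is its image under [euler]. *)
move: fq (_%:R) fqn euler_fq => {q qn f} f a fn.
rewrite (euler_expand fn) => fE.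
have Pcontract : P n.+1 (\sum_i mul_cochain (wedge1 (dual_vbasis i))
    (Cochain (contract_cochain e`_i fn) : cochain n)).
  by apply: Psum => i; apply/Pw/IH.
(* In degree 1 the symmetric sum vanishes, because [partial] lowers the degree by 2. *)
case: n IH f fn fE Pcontract => [|n] IH f fn fE Pcontract.
  congr (P 1%N _): Pcontract; apply: val_inj; rewrite [RHS]cochain_valZ [RHS]fE.
  rewrite [LHS]cochain_val_sum /= [X in _ + X]big1 ?addr0 // => i _.
  by rewrite (partial0 _ _ fn) // mulform0.
have Ppartial : P n.+2 (\sum_i mul_cochain (sym1 (dual_vbasis i))
    (Cochain (partial_cochain e`_i fn) : cochain n)).
  by apply: Psum => i; apply/Ps/IH.
congr (P _ _): (PL _ 1 _ _ Pcontract Ppartial); apply: val_inj.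
by rewrite scale1r [RHS]cochain_valZ [RHS]fE [LHS]cochain_valD !cochain_val_sum.
Qed.

End Generators.

(** * The differential squares to zero *)

Section WeilDifferential.
Variables (R : realType) (g : vectType R).
Local Notation form := (seq g -> seq g -> R^o).
Local Notation dual := 'Hom(g, R^o).
Local Notation cochain := (cochain g).
Implicit Types (f h k : form) (alpha beta : dual) (xs vs : seq g).

Local Notation e := (vbasis {:g}).

(** The Leibniz rule on 1 * 1 = 1 gives X 1 = X 1 + X 1. *)
Lemma odd_derivative_const (X : forall n, {linear cochain n -> cochain n.+1}) a :
  odd_derivative X -> X 0%N (const_cochain g a) = 0.
Proof.
move=> hX; have -> : const_cochain g a = a *: const_cochain g 1.
  by apply: val_inj; rewrite [RHS]cochain_valZ -const_formE.
rewrite linearZ /=.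
have E : mul_cochain (const_cochain g 1) (const_cochain g 1) = const_cochain g 1.
  by apply: val_inj; exact: mul_form1.
have := hX 0%N 0%N (const_cochain g 1) (const_cochain g 1).
rewrite [in X in X -> _]E expr0 scale1r mul_form1 mul_1form => /eqP.
rewrite -subr_eq subrr eq_sym => /eqP X0.
by rewrite (_ : X _ _ = 0) ?scaler0 //; apply: val_inj; rewrite /= X0.
Qed.

Lemma odd_derivativeD (X Y : forall n, {linear cochain n -> cochain n.+1}) :
  odd_derivative X -> odd_derivative Y -> odd_derivative (fun n => X n \+ Y n).
Proof.
move=> hX hY m n b c; rewrite [LHS]cochain_valD hX hY addrACA -scalerDr.
by rewrite !cochain_valD mul_formD mul_formDr.
Qed.

Variable br : {bilinear g -> g -> g}.
Hypothesis br_skew : forall x y, br x y = - br y x.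

(** The coadjoint action of x on alpha. *)
Definition coad alpha x : dual := (- (alpha \o linfun (br x)))%VF.

Lemma coadE alpha x y : coad alpha x y = - alpha (br x y).
Proof. by rewrite /coad opp_lfunE comp_lfunE lfunE. Qed.

Lemma contract_D_wedge1 alpha x : contract x (D_wedge1 br alpha) = wedge1_form (coad alpha x).
Proof.
apply/funext=> [[|y [|z xs]]]; apply/funext=> [[|v vs]] //=.
by rewrite coadE.
Qed.

(** [euler] acts as 2 on a form with two exterior arguments, whence the factor 1/2. *)
Lemma D_wedge1_expand alpha : D_wedge1 br alpha = 2^-1 *:
  \sum_i mul_form (wedge1_form (dual_vbasis i)) (wedge1_form (coad alpha e`_i)).
Proof.
have Dn := D_wedge1_cochain br_skew alpha.
have E : euler (D_wedge1 br alpha) = 2 *: D_wedge1 br alpha.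
  apply/funext=> [[|x [|y [|z xs]]]]; apply/funext=> [[|v vs]];
    by rewrite Defs.formZ /euler /= ?mulr0.
have := euler_expand Dn; rewrite E [X in _ + X]big1 => [|i _]; last first.
  by rewrite (_ : partial _ _ = 0) ?mulform0 //; apply/funext=> [[|x [|y [|z xs]]]].
rewrite addr0 => E2.
have {1}-> : D_wedge1 br alpha = 2^-1 *: (2 *: D_wedge1 br alpha).
  by rewrite scalerA mulVf ?scale1r // pnatr_eq0.
by rewrite E2; congr (_ *: _); apply: eq_bigr => i _; rewrite contract_D_wedge1.
Qed.

Variable d : forall n, {linear cochain n -> cochain n.+1}.
Hypothesis d_odd : odd_derivative d.
Hypothesis d_wedge1 : forall alpha,
  d 1 (wedge1 alpha) = D_wedge1 br alpha + sym1_form alpha :> form.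
Hypothesis d_sym1 : forall beta,
  d 2 (sym1 beta) = D_sym1 br beta + J_sym1 br beta :> form.

(** The only solutions of p + 2q = 3 are (3, 0) and (1, 1). *)
Lemma cochain3_ext f h : f \in is_cochain 3 -> h \in is_cochain 3 ->
  (forall x y z, f [:: x; y; z] [::] = h [:: x; y; z] [::]) ->
  (forall x v, f [:: x] [:: v] = h [:: x] [:: v]) -> f = h.
Proof.
move=> /asboolP[fd _ _] /asboolP[hd _ _] E30 E11; apply/funext=> xs; apply/funext=> vs.
by case: xs vs => [|x [|y [|z [|t xs]]]] [|v [|w vs]] //; rewrite fd ?hd //=; lia.
Qed.

(** On exterior covectors this says that D^2 = - J delta, where the failure of the Jacobi identity
    appears, and that delta D = - D delta. Both come from the Leibniz rule applied to
    [D_wedge1_expand]. *)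
Lemma d_D_wedge1 alpha : d 2 (Cochain (D_wedge1_cochain br_skew alpha)) =
  - D_sym1 br alpha - J_sym1 br alpha :> form.
Proof.
pose w i := mul_cochain (wedge1 (dual_vbasis i)) (wedge1 (coad alpha e`_i)).
pose W := 2^-1 *: \sum_i w i : cochain 2.
have -> : Cochain (D_wedge1_cochain br_skew alpha) = W.
  by apply: val_inj; rewrite [RHS]cochain_valZ [LHS]D_wedge1_expand cochain_val_sum.
have sumE u v : \sum_i dual_vbasis i u * alpha (br e`_i v) = alpha (br u v).
  apply: (@sum_dual_vbasis _ _ R^o (fun u => alpha (br u v))) => a x y.
  by rewrite linearPl linearP.
have skewE beta u v : beta (br u v) = - beta (br v u) by rewrite br_skew linearN.
have alphaD u v : alpha (u + v) = alpha u + alpha v by rewrite linearD.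
have two : (2 : R) != 0 by rewrite pnatr_eq0.
apply: cochain3_ext => [||x y z|x v].
- exact: valP (d 2 W).
- by rewrite rpredB ?rpredN ?(D_sym1_cochain br) ?(J_sym1_cochain br_skew).
all: rewrite /W linearZ linear_sum [in LHS]cochain_valZ cochain_val_sum Defs.formZ form_sumE.
all: under eq_bigr => i _ do rewrite d_odd !d_wedge1 expr1 scaleN1r.
(* The terms are arranged in two cyclic triples. After summation and skew-symmetry each equals minus
   alpha of the Jacobiator, and the factor 1/2 leaves one copy. *)
- under eq_bigr => i _.
    rewrite (_ : _ [:: x; y; z] [::] =
      dual_vbasis i (br x y) * alpha (br e`_i z) + dual_vbasis i (br y z) * alpha (br e`_i x)
      + dual_vbasis i (br z x) * alpha (br e`_i y)
      - (dual_vbasis i x * alpha (br e`_i (br y z)) + dual_vbasis i y * alpha (br e`_i (br z x))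
      + dual_vbasis i z * alpha (br e`_i (br x y)))); last first.
      rewrite Defs.formD formNE /= /contract /parity /=.
      rewrite !Defs.formD /= !coadE (skewE (dual_vbasis i) x z).
      rewrite (_ : br x z = - br z x) // linearNr linearN /= !expr0 !exprS !expr0; ring.
    over.
  rewrite !(sumrB, big_split) /= !sumE Defs.formD !formNE /= /jacobiator.
  rewrite (skewE alpha (br x y)) (skewE alpha (br y z)) (skewE alpha (br z x)) !alphaD.
  by field.
under eq_bigr => i _.
  rewrite (_ : _ [:: x] [:: v] =
    dual_vbasis i x * alpha (br e`_i v) - dual_vbasis i v * alpha (br e`_i x)); last first.
    rewrite Defs.formD formNE /= /contract /parity /= !Defs.formD /= !coadE.
    rewrite !expr0 ?expr1; ring.
  over.
rewrite sumrB !sumE Defs.formD !formNE /=.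
rewrite (skewE alpha v x).
by field.
Qed.

Lemma d_square_wedge1 alpha : d 2 (d 1 (wedge1 alpha)) = 0.
Proof.
have -> : d 1 (wedge1 alpha) = Cochain (D_wedge1_cochain br_skew alpha) + sym1 alpha :> cochain 2.
  by apply: val_inj; rewrite [LHS]d_wedge1 [RHS]cochain_valD.
apply: val_inj; rewrite linearD [LHS]cochain_valD d_D_wedge1 d_sym1 [RHS]cochain_val0.
by rewrite -opprD addNr.
Qed.

Lemma d_mul_wedge1 n alpha (c : cochain n) : d n.+1 (mul_cochain (wedge1 alpha) c) =
  (mul_cochain (d 1 (wedge1 alpha)) c : cochain n.+2) -
  (mul_cochain (wedge1 alpha) (d n c) : cochain n.+2).
Proof.
apply: val_inj; rewrite [RHS]cochain_valD cochain_valN.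
by rewrite [LHS]d_odd expr1 scaleN1r.
Qed.

Lemma d_mul2 n (b : cochain 2) (c : cochain n) : d n.+2 (mul_cochain b c) =
  (mul_cochain (d 2 b) c : cochain n.+3) + (mul_cochain b (d n c) : cochain n.+3).
Proof.
by apply: val_inj; rewrite [RHS]cochain_valD [LHS]d_odd sqrrN expr1n scale1r.
Qed.

Lemma d_mul3 n (b : cochain 3) (c : cochain n) : d n.+3 (mul_cochain b c) =
  (mul_cochain (d 3 b) c : cochain n.+4) - (mul_cochain b (d n c) : cochain n.+4).
Proof.
apply: val_inj; rewrite [RHS]cochain_valD cochain_valN.
by rewrite [LHS]d_odd exprS sqrrN expr1n mulr1 scaleN1r.
Qed.

Lemma mul_cochain0 m n (b : cochain m) : mul_cochain b (0 : cochain n) = 0.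
Proof. by apply: val_inj; exact: mulform0. Qed.

Lemma mul_0cochain m n (b : cochain m) : mul_cochain (0 : cochain n) b = 0.
Proof. by apply: val_inj; exact: mul0form. Qed.

Lemma d_square_mul_wedge1 n alpha (c : cochain n) : d n.+1 (d n c) = 0 ->
  d n.+2 (d n.+1 (mul_cochain (wedge1 alpha) c)) = 0.
Proof.
move=> ddc; rewrite d_mul_wedge1 linearB /= d_mul2 d_mul_wedge1 d_square_wedge1 ddc.
by rewrite mul_cochain0 mul_0cochain add0r subr0 subrr.
Qed.

(** No direct computation with the Jacobiator: beta = d alpha - D alpha, and D alpha is a sum of
    products of exterior covectors, on which d^2 is already known to vanish. *)
Lemma d_square_sym1 beta : d 3 (d 2 (sym1 beta)) = 0.
Proof.
pose w i := mul_cochain (wedge1 (dual_vbasis i)) (wedge1 (coad beta e`_i)).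
have -> : sym1 beta = d 1 (wedge1 beta) - 2^-1 *: (\sum_i w i : cochain 2) :> cochain 2.
  apply: val_inj; rewrite [RHS]cochain_valD cochain_valN cochain_valZ d_wedge1.
  by rewrite cochain_val_sum -D_wedge1_expand addrC addKr.
rewrite !linearB /= d_square_wedge1 linear0 sub0r linearZ /= linearZ /= !linear_sum.
by rewrite big1 // => i _; rewrite (d_square_mul_wedge1 _ (d_square_wedge1 _)) /= scaler0 oppr0.
Qed.

(** The cross terms of d^2 on a product cancel by sign, so vanishing on generators suffices. *)
Lemma d_square0 n (c : cochain n) : d n.+1 (d n c) = 0.
Proof.
elim/cochain_ind: n / c => [n|n a b c ddb ddc||n alpha c ddc|n beta c ddc].
- by rewrite !linear0.
- by rewrite !linearP /= ddb ddc scaler0 addr0.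
- by rewrite odd_derivative_const // linear0.
- exact: d_square_mul_wedge1.
rewrite d_mul2 linearD /= d_mul3 d_mul2 d_square_sym1 ddc.
by rewrite mul_cochain0 mul_0cochain add0r addr0 addNr.
Qed.

End WeilDifferential.

(** * The contracting derivation s and the homotopy formula *)

Section KoszulHomotopy.
Variables (R : realType) (g : vectType R).
Local Notation form := (seq g -> seq g -> R^o).
Local Notation dual := 'Hom(g, R^o).
Local Notation cochain := (cochain g).
Implicit Types (f h k : form) (alpha beta : dual) (xs vs : seq g).

Local Notation e := (vbasis {:g}).

(* The derivation that kills wedge^1 and sends beta in S^1 to W beta. *)
Definition partial_by (W : dual -> form) f : form :=
  \sum_i mul_form (W (dual_vbasis i)) (partial e`_i f).

Lemma partial_by_linear W a f h :
  partial_by W (a *: f + h) = a *: partial_by W f + partial_by W h.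
Proof.
rewrite /partial_by scaler_sumr -big_split; apply: eq_bigr => i _ /=.
by rewrite -mul_formZr -mul_formDr.
Qed.

Lemma partial_byD W f h : partial_by W (f + h) = partial_by W f + partial_by W h.
Proof. by have := partial_by_linear W 1 f h; rewrite !scale1r. Qed.

Lemma partial_by0 W : partial_by W 0 = 0.
Proof. by rewrite /partial_by big1 // => i _; exact: mulform0. Qed.

Lemma partial_byZ W a f : partial_by W (a *: f) = a *: partial_by W f.
Proof. by rewrite -[a *: f]addr0 partial_by_linear partial_by0 addr0. Qed.

Lemma partial_byN W f : partial_by W (- f) = - partial_by W f.
Proof. by rewrite -scaleN1r partial_byZ scaleN1r. Qed.

(** [odd] is the common parity of the values of W, which have to be moved past f. *)
Lemma partial_by_mul W (odd : bool) f h :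
  (forall alpha, parity (W alpha) = (-1) ^+ odd *: W alpha) ->
  partial_by W (mul_form f h) =
  mul_form (partial_by W f) h + mul_form (iter odd (@parity R g) f) (partial_by W h).
Proof.
move=> WP; rewrite mul_form_suml mul_form_sumr -big_split; apply: eq_bigr => i _ /=.
by rewrite partial_mul mul_formDr !mul_formA (mul_formC f (WP _)).
Qed.

Lemma partial_by_wedge1 W alpha : partial_by W (wedge1_form alpha) = 0.
Proof. by rewrite /partial_by big1 // => i _; rewrite partial_wedge1 mulform0. Qed.

Lemma partial_by_sym1 (W : dual -> form) beta : linear W ->
  partial_by W (sym1_form beta) = W beta.
Proof.
move=> Wl; pose W' : {linear dual -> form} :=
  HB.pack W (GRing.isLinear.Build R dual form _ W Wl).
rewrite -[RHS]/(W' beta) [in RHS](dual_expand beta) linear_sum.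
by apply: eq_bigr => i _; rewrite partial_sym1 mul_formZr mul_form1 linearZ.
Qed.

Fact wedge1_form_linear : linear (@wedge1_form R g).
Proof.
move=> a f h; apply/funext=> xs; apply/funext=> vs; rewrite Defs.formD Defs.formZ.
by case: xs vs => [|x [|y xs]] [|v vs] /=;
  rewrite ?mulr0 ?addr0 // add_lfunE scale_lfunE.
Qed.

Local Notation koszul := (partial_by (@wedge1_form R g)).

Lemma koszul_mul n f h : f \in is_cochain n ->
  koszul (mul_form f h) = mul_form (koszul f) h + (-1) ^+ n *: mul_form f (koszul h).
Proof.
move=> fn; rewrite (@partial_by_mul _ true) /=; last first.
  by move=> alpha; rewrite parity_wedge1 expr1 scaleN1r.
by rewrite (parity_cochain fn) mul_formZ.
Qed.

Lemma koszul_cochain n f : f \in is_cochain n -> koszul f \in is_cochain n.-1.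
Proof.
move=> fn; apply: rpred_sum => i _.
case: n fn => [|[|n]] fn.
1,2: by rewrite (partial0 _ _ fn) // mulform0 rpred0.
exact: mul_is_cochain (wedge1_subproof _) (partial_cochain _ fn).
Qed.

(* In degree 0, where n.-1 is again 0, this map is zero. *)
Definition koszul_fun n (c : cochain n) : cochain n.-1 := Cochain (koszul_cochain (valP c)).

Fact koszul_fun_linear n : linear (@koszul_fun n).
Proof.
move=> a b c; apply: val_inj; rewrite [RHS]cochain_val_linear -partial_by_linear.
by rewrite -[LHS]/(koszul (a *: b + c : cochain n)) cochain_val_linear.
Qed.
HB.instance Definition _ n := GRing.isLinear.Build R (cochain n) (cochain n.-1) _ _
  (@koszul_fun_linear n).

Lemma koszul_fun0 (c : cochain 0) : koszul_fun c = 0.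
Proof.
apply: val_inj; rewrite [RHS]cochain_val0 /= /partial_by big1 // => i _.
by rewrite (partial0 _ _ (valP c)) // mulform0.
Qed.

Variable br : {bilinear g -> g -> g}.
Hypothesis br_skew : forall x y, br x y = - br y x.

Local Notation corr := (partial_by (D_wedge1 br)).

Lemma corr_mul f h : corr (mul_form f h) = mul_form (corr f) h + mul_form f (corr h).
Proof.
rewrite (@partial_by_mul _ false) // => alpha.
by rewrite (parity_cochain (D_wedge1_cochain br_skew _)) sqrrN expr1n.
Qed.

Lemma koszul_D_wedge1 alpha : koszul (D_wedge1 br alpha) = 0.
Proof.
rewrite /partial_by big1 // => i _.
by rewrite (_ : partial _ _ = 0) ?mulform0 //; apply/funext=> [[|x [|y [|z xs]]]].
Qed.

Lemma koszul_J_sym1 beta : koszul (J_sym1 br beta) = 0.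
Proof.
rewrite /partial_by big1 // => i _.
by rewrite (_ : partial _ _ = 0) ?mulform0 //; apply/funext=> [[|x [|y [|z [|t xs]]]]].
Qed.

(** Making the symmetric argument exterior antisymmetrises a bracket that is already skew, which
    doubles it. *)
Lemma koszul_D_sym1 beta : koszul (D_sym1 br beta) = - (2 *: D_wedge1 br beta).
Proof.
have -> : koszul (D_sym1 br beta) = - \sum_i mul_form (wedge1_form (dual_vbasis i))
    (wedge1_form (coad br beta e`_i)).
  rewrite -sumrN; apply: eq_bigr => i _; rewrite -mul_formNr; congr mul_form.
  apply/funext=> [[|x [|y xs]]]; apply/funext=> [[|v vs]]; rewrite formNE ?oppr0 //=.
  by rewrite coadE /partial /= (br_skew x) linearN.
by rewrite (D_wedge1_expand br_skew beta) scalerA mulfV ?pnatr_eq0 // scale1r.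
Qed.

Variable d : forall n, {linear cochain n -> cochain n.+1}.
Hypothesis d_odd : odd_derivative d.
Hypothesis d_wedge1 : forall alpha,
  d 1 (wedge1 alpha) = D_wedge1 br alpha + sym1_form alpha :> form.
Hypothesis d_sym1 : forall beta,
  d 2 (sym1 beta) = D_sym1 br beta + J_sym1 br beta :> form.

(** Stated on forms, because [n.-1.+1] and [n] are not convertible. Degree 0, where s vanishes, is
    treated apart. *)
Lemma d_koszul_mul_wedge1 n alpha (c : cochain n) :
  d n (koszul_fun (mul_cochain (wedge1 alpha) c)) =
  mul_form (wedge1_form alpha) (d n.-1 (koszul_fun c))
  - mul_form (d 1 (wedge1 alpha)) (koszul_fun c) :> form.
Proof.
have E : koszul (mul_form (wedge1_form alpha) c) = - mul_form (wedge1_form alpha) (koszul c).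
  by rewrite (koszul_mul _ (wedge1_subproof alpha)) partial_by_wedge1 mul0form add0r scaleN1r.
case: n c E => [|n] c E.
  have c0 : koszul c = 0 by rewrite -[LHS]/(koszul_fun c : form) koszul_fun0 cochain_val0.
  rewrite (_ : koszul_fun _ = 0).
    by rewrite koszul_fun0 !linear0 !cochain_val0 !mulform0 subrr.
  by apply: val_inj; rewrite [RHS]cochain_val0 [LHS]E c0 mulform0 oppr0.
have -> : koszul_fun (mul_cochain (wedge1 alpha) c) =
    - (mul_cochain (wedge1 alpha) (koszul_fun c) : cochain n.+1).
  by apply: val_inj; rewrite [RHS]cochain_valN.
rewrite linearN d_mul_wedge1 // opprB cochain_valD cochain_valN //.
Qed.

Lemma d_koszul_mul_sym1 n beta (c : cochain n) :
  d n.+1 (koszul_fun (mul_cochain (sym1 beta) c)) =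
  (mul_form (d 1 (wedge1 beta)) c - mul_form (wedge1_form beta) (d n c)) +
  (mul_form (d 2 (sym1 beta)) (koszul_fun c)
   + mul_form (sym1_form beta) (d n.-1 (koszul_fun c))) :> form.
Proof.
have E : koszul (mul_form (sym1_form beta) c) =
    mul_form (wedge1_form beta) c + mul_form (sym1_form beta) (koszul c).
  rewrite (koszul_mul _ (sym1_subproof beta)) partial_by_sym1; last exact: wedge1_form_linear.
  by rewrite sqrrN expr1n scale1r.
case: n c E => [|n] c E.
  have c0 : koszul c = 0 by rewrite -[LHS]/(koszul_fun c : form) koszul_fun0 cochain_val0.
  have -> : koszul_fun (mul_cochain (sym1 beta) c) = mul_cochain (wedge1 beta) c.
    by apply: val_inj; rewrite [LHS]E c0 mulform0 addr0.
  rewrite d_mul_wedge1 // cochain_valD cochain_valN.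
  by rewrite koszul_fun0 !linear0 !cochain_val0 !mulform0 !addr0.
have -> : koszul_fun (mul_cochain (sym1 beta) c) =
    (mul_cochain (wedge1 beta) c : cochain n.+2) +
    (mul_cochain (sym1 beta) (koszul_fun c) : cochain n.+2).
  by apply: val_inj; rewrite [RHS]cochain_valD.
by rewrite linearD d_mul_wedge1 // d_mul2 // !cochain_valD cochain_valN.
Qed.

(** Both sides are derivations of degree 0, so generators decide. On alpha both give alpha, since s
    d alpha = s (D alpha + beta) = alpha. On beta, d s beta = D alpha + beta and s d beta = - 2 D
    alpha, with sum beta - D alpha. *)
Lemma koszul_homotopy n (c : cochain n) :
  (d n.-1 (koszul_fun c) : form) + koszul (d n c) = euler c - corr c.
Proof.
have koszul_d1 alpha : koszul (d 1 (wedge1 alpha)) = wedge1_form alpha.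
  rewrite d_wedge1 partial_byD koszul_D_wedge1 add0r partial_by_sym1 //.
  exact: wedge1_form_linear.
have cochainP m (b : cochain m) : (b : form) \in is_cochain m by exact: valP.
elim/cochain_ind: n / c => [n|n a b c IHb IHc||n alpha c IH|n beta c IH].
- rewrite !linear0 !cochain_val0 !partial_by0 addr0 subr0.
  by apply/funext=> xs; apply/funext=> vs; rewrite /euler mulr0.
- rewrite !linearP !cochain_valD !cochain_valZ !partial_by_linear addrACA -scalerDr IHb IHc.
  apply/funext=> xs; apply/funext=> vs.
  rewrite !(Defs.formD, Defs.formZ, formNE) /euler !(Defs.formD, Defs.formZ); ring.
- rewrite koszul_fun0 odd_derivative_const // linear0 !cochain_val0 partial_by0 addr0.
  rewrite [X in _ - X](_ : _ = 0); last first.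
    rewrite /partial_by big1 // => i _; rewrite (partial0 _ _ (valP _)) ?mulform0 //.
  by apply/funext=> [[|x xs]]; apply/funext=> [[|v vs]]; rewrite subr0 /euler /= ?mulr0 ?mul0r.
- rewrite d_koszul_mul_wedge1 d_mul_wedge1 // cochain_valD cochain_valN partial_byD partial_byN.
  rewrite (koszul_mul _ (cochainP _ (d 1 (wedge1 alpha)))) (koszul_mul _ (wedge1_subproof alpha)).
  rewrite koszul_d1 sqrrN expr1n scale1r expr1 scaleN1r partial_by_wedge1 mul0form add0r.
  rewrite euler_mul corr_mul partial_by_wedge1 mul0form add0r.
  have -> : euler (wedge1_form alpha) = wedge1_form alpha.
    by apply/funext=> [[|x [|y xs]]]; apply/funext=> [[|v vs]]; rewrite /euler /= ?mulr0 ?mul1r.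
  (* The induction hypothesis, solved for [euler c]; what remains is cancellation of the Leibniz
     cross terms. *)
  have -> : euler c = (d n.-1 (koszul_fun c) : form) + koszul (d n c) + corr c.
    by rewrite IH subrK.
  rewrite !mul_formDr; apply/funext=> xs; apply/funext=> vs.
  rewrite !(Defs.formD, formNE) [koszul_fun c : form]/=; ring.
rewrite d_koszul_mul_sym1 d_mul2 // cochain_valD partial_byD.
rewrite (koszul_mul _ (cochainP _ (d 2 (sym1 beta)))) (koszul_mul _ (sym1_subproof beta)).
rewrite [in koszul (d 2 _)]d_sym1 partial_byD koszul_J_sym1 koszul_D_sym1 addr0.
rewrite exprS sqrrN expr1n mulr1 scaleN1r scale1r.
rewrite partial_by_sym1; last exact: wedge1_form_linear.
rewrite euler_mul corr_mul partial_by_sym1; last exact: D_wedge1_linear.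
have -> : euler (sym1_form beta) = sym1_form beta.
  by apply/funext=> [[|x xs]]; apply/funext=> [[|v [|w vs]]]; rewrite /euler /= ?mulr0 ?mul1r.
have -> : euler c = (d n.-1 (koszul_fun c) : form) + koszul (d n c) + corr c.
  by rewrite IH subrK.
rewrite d_wedge1 mul_formN mul_formZ !mul_formDr !mul_formD; apply/funext=> xs; apply/funext=> vs.
rewrite !(Defs.formD, Defs.formZ, formNE) [koszul_fun c : form]/=; ring.
Qed.

End KoszulHomotopy.

(** * Vanishing of classes in a quotient module *)

Section QuotientZero.
Variables (R : pzRingType) (V : lmodType R) (B : {pred V}) (B_submod : submod_closed B).
Local Open Scope quotient_scope.

Lemma quotmod_pi_linear : linear (\pi_(quotmod B_submod) : V -> quotmod B_submod).
Proof.
move=> a x y.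
by rewrite -[RHS]/(quot_scale a (\pi_(quotmod B_submod) x) + \pi_(quotmod B_submod) y) !piE.
Qed.

Lemma quotmod_eq0 (x : V) : (\pi_(quotmod B_submod) x == 0 :> quotmod B_submod) = (x \in B).
Proof.
have pi0 : \pi_(quotmod B_submod) 0 = 0 :> quotmod B_submod.
  by rewrite -[X in \pi X](subrr 0) addrC -scaleN1r quotmod_pi_linear scaleN1r addNr.
rewrite -pi0 -[x in RHS]subr0.
rewrite (_ : (x - 0 \in B) = (x - 0 \in submod_pred B_submod)) //.
by rewrite (Quotient.idealrBE (submod_pred B_submod)).
Qed.
End QuotientZero.

(** * Descent on the number of symmetric arguments, and the cohomology *)

Section Acyclicity.
Variables (R : realType) (g : vectType R).
Local Notation form := (seq g -> seq g -> R^o).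
Local Notation dual := 'Hom(g, R^o).
Local Notation cochain := (cochain g).
Local Open Scope quotient_scope.

(** As f absorbs no symmetric argument, all of them go to h. *)
Lemma mul_form_low q (f h : form) xs vs : (forall v, partial v f = 0) ->
  (forall xs' vs', (q <= size vs')%N -> h xs' vs' = 0) ->
  (q <= size vs)%N -> mul_form f h xs vs = 0.
Proof.
move=> f0; elim: vs q h => [|v vs IH] q h h0 qvs; last first.
  rewrite mul_form_consr partial_mul f0 mul0form add0r (IH q.-1) //.
    by move=> xs' vs' q1; apply: h0 => /=; lia.
  by rewrite /= in qvs; lia.
rewrite (_ : h = 0) ?mulform0 //; apply/funext=> xs'; apply/funext=> vs'.
by apply: h0; exact: leq_trans qvs _.
Qed.

Variable br : {bilinear g -> g -> g}.
Hypothesis br_skew : forall x y, br x y = - br y x.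
Variable d : forall n, {linear cochain n -> cochain n.+1}.
Hypothesis d_odd : odd_derivative d.
Hypothesis d_wedge1 : forall alpha,
  d 1 (wedge1 alpha) = D_wedge1 br alpha + sym1_form alpha :> form.
Hypothesis d_sym1 : forall beta,
  d 2 (sym1 beta) = D_sym1 br beta + J_sym1 br beta :> form.

(** Each step removes the component of c with the most symmetric arguments by subtracting a
    coboundary; at q = 0 nothing is left. *)
Lemma cocycle_exact q n (c : cochain n.+1) : d n.+1 c = 0 ->
  (forall xs vs, (q <= size vs)%N -> c xs vs = 0) -> exists b, c = d n b.
Proof.
elim: q c => [|q IH] c dc clow.
  exists 0; rewrite linear0; apply: val_inj; rewrite [RHS]cochain_val0.
  by apply/funext=> xs; apply/funext=> vs; exact: clow.
have /asboolP[cdeg _ _] := valP c.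
have [qn|nq] := leqP (2 * q) n.+1; last first.
  by apply: IH => // xs vs qvs; apply: cdeg; lia.
(* The value of p + q on the top component, where p + 2q = n + 1. *)
pose w : R := (n.+1 - q)%:R; have w0 : w != 0 by rewrite pnatr_eq0; lia.
pose b := w^-1 *: koszul_fun c : cochain n.
have [||b' c'E] := IH (c - d n b).
- by rewrite linearB /= dc (d_square0 br_skew) // subrr.
- move=> xs vs qvs.
  have := congr1 (fun f : form => f xs vs) (koszul_homotopy br_skew d_odd d_wedge1 d_sym1 c).
  rewrite dc cochain_val0 partial_by0 addr0 !Defs.formD formNE.
  (* K c has fewer than q symmetric arguments: [partial] uses up one and [D_wedge1] supplies
     none. *)
  rewrite [X in _ - X](_ : _ = 0) ?subr0 => [dE|]; last first.
    rewrite /partial_by form_sumE big1 // => i _; apply: (@mul_form_low q) => //.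
      by move=> v; apply/funext=> [[|x [|y [|z xs']]]]; apply/funext.
    by move=> xs' vs' qvs'; apply: clow.
  rewrite cochain_valD cochain_valN /b linearZ cochain_valZ Defs.formD formNE Defs.formZ dE.
  rewrite /euler; case: (ltnP q (size vs)) => [qlt|vsq].
    by rewrite clow // !mulr0 subr0.
  have [E|/eqP ne] := eqVneq (size xs + 2 * size vs)%N n.+1; last first.
    by rewrite [c xs vs]cdeg // !mulr0 subr0.
  rewrite (_ : size xs + size vs = n.+1 - q)%N; last by lia.
  by rewrite mulKf // subrr.
by exists (b' + b); rewrite linearD -c'E subrK.
Qed.

Lemma cohomology_succ n (c : cohomology d n.+1) : c = 0.
Proof.
rewrite -[c]reprK; apply/eqP; rewrite quotmod_eq0; apply/asboolP.
(* With n + 2 or more symmetric arguments the degree would exceed n + 1. *)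
case: (repr c) => z /= /eqP dz; apply: (@cocycle_exact n.+2) => // xs vs nvs.
by have /asboolP[zd _ _] := valP z; apply: zd; lia.
Qed.

Local Notation class0 := (\pi_(quotmod (@is_coboundary_submod _ _ d 0))).

Lemma const_cocycle_subproof a : const_cochain g a \in @is_cocycle _ _ d 0.
Proof. by rewrite inE odd_derivative_const. Qed.

Definition const_class (a : R^o) : cohomology d 0 :=
  class0 (Cocycle (const_cocycle_subproof a)).

Lemma const_class_linear : linear const_class.
Proof.
move=> a x y; rewrite /const_class -quotmod_pi_linear; congr (class0 _).
apply: val_inj; rewrite [RHS](linearP \val); apply: val_inj.
rewrite [RHS]cochain_valD cochain_valZ /=.
by apply/funext=> [[|t xs]]; apply/funext=> [[|v vs]];
  rewrite Defs.formD Defs.formZ /= ?mulr0 ?addr0.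
Qed.

Lemma const_class_bij : bijective const_class.
Proof.
(* In degree 0 a coboundary is 0 by the definition of [in_image], so representatives are unique. *)
have class0_eq0 z : class0 z = 0 :> cohomology d 0 -> z = 0.
  move/eqP; rewrite quotmod_eq0 => /asboolP /= z0.
  by apply: val_inj; rewrite [LHS]z0 [RHS](linear0 \val).
(* The inverse evaluates the representative on no arguments, which determines a cochain of degree
   0. *)
exists (fun c : cohomology d 0 => cochain_val (\val (repr c : cocycle d 0)) [::] [::])
  => [a|c]; last first.
  rewrite -[RHS]reprK /const_class; congr (class0 _); apply: val_inj; apply: val_inj.
  by rewrite [RHS](cochain0E (valP _)) -const_formE.
have E : repr (const_class a) = Cocycle (const_cocycle_subproof a).
  apply/eqP; rewrite -subr_eq0 addrC -scaleN1r; apply/eqP/class0_eq0.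
  by rewrite quotmod_pi_linear reprK scaleN1r addNr.
by rewrite E.
Qed.

End Acyclicity.

Theorem proposition5p2 (R : realType) (g : vectType R)
  (br : {bilinear g -> g -> g}) (br_skew : forall x y, br x y = - br y x)
  (D J delta : forall n, {linear cochain g n -> cochain g n.+1})
  (hD : is_D br D) (hJ : is_Jhat br J) (hdelta : is_deltahat delta) :
  (exists phi : {linear R^o -> cohomology (differential D J delta) 0}, bijective phi) /\
  (forall n, (0 < n)%N -> forall c : cohomology (differential D J delta) n, c = 0).
Proof.
case: hD hJ hdelta => [D_odd D1 D2] [J_odd J1 J2] [delta_odd delta1 delta2].
have d_odd : odd_derivative (differential D J delta).
  exact: (odd_derivativeD (odd_derivativeD D_odd J_odd) delta_odd).
have dE n c : differential D J delta n c =
    (D n c : seq g -> seq g -> R^o) + J n c + delta n c :> (seq g -> seq g -> R^o).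
  by rewrite [LHS]cochain_valD cochain_valD.
split.
  pose phi : {linear R^o -> cohomology (differential D J delta) 0} :=
    HB.pack (const_class d_odd)
      (GRing.isLinear.Build R R^o _ _ (const_class d_odd) (const_class_linear d_odd)).
  exists phi; exact: const_class_bij.
case=> // n _; apply: (cohomology_succ br_skew d_odd).
  by move=> alpha; rewrite dE D1 J1 delta1 cochain_val0 addr0.
by move=> beta; rewrite dE D2 J2 delta2 cochain_val0 addr0.
Qed.
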